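(* On the hyperboloid model $\mathbb H^n$, consider the cost $\mathsf c(x,\bar x)=\mathsf u(x^{\mathfrak t}\bar x)$, where $\mathsf u$ is the inverse of a function $\mathsf s$ (restricted to the indicated range of $u$). In each of the following cases the cost satisfies A3s for all $(x,\bar x)\in\mathbb H^n\times\mathbb H^n$: 1. (Generalized hyperbolic, sinh-like) $\mathsf s(u)=p_0e^{p_1u}+p_2e^{p_3u}$ with $p_0<0$, $p_1<0$, $p_2>0$, $-p_1\ge p_3\ge0$. 2. (Generalized hyperbolic, one-side range) $\mathsf s(u)=p_0e^{p_1u}+p_2e^{p_3u}$ with $p_0<0$, $p_1<0$, $p_2>0$, $p_1<p_3<0$, with range $u\le u_c=\frac{1}{p_1-p_3}\log\frac{-p_2p_3}{p_0p_1}$. 3. (Lambert) $\mathsf s(u)=(a_0+a_1u)e^{a_2u}$ with $a_1>0$, $a_2<0$, with range $u\le u_c=-\frac{a_0a_2+a_1}{a_1a_2}$; here $\mathsf c(x,\bar x)=\frac1{a_2}W_0\!\Big(\frac{a_2\exp(a_0a_2/a_1)}{a_1}\,x^{\mathfrak t}\bar x\Big)-\frac{a_0}{a_1}$, where $W_0$ is the principal branch of the Lambert function. 4. (Affine) $\mathsf s(u)=a_0+a_1u$ with $a_1>0$; here $\mathsf c(x,\bar x)=\frac1{a_1}(x^{\mathfrak t}\bar x-a_0)$. Additionally, for real $p_0\ne0$ and $p_1\neq0$, the cost $\mathsf c(x,\bar x)=-\frac1{|p_1|}\log\Big(\frac{1-x^{\mathfrak t}\bar x}{|p_0|}\Big)$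 satisfies A3s on $\mathbb H^n\times\mathbb H^n$, and the cost $\mathsf c(x,\bar x)=\frac1{p_1}\log\Big(\frac{-x^{\mathfrak t}\bar x}{|p_0|}\Big)$ satisfies A3w on $\mathbb H^n\times\mathbb H^n$.
   Context: On $\mathbb R^{n+1}$ put $x^{\mathfrak t}y:=-x_0y_0+\sum_{i=1}^nx_iy_i$. The hyperboloid model is $\mathbb H^n=\{x\in\mathbb R^{n+1}: x^{\mathfrak t}x=-1,\ x_0>0\}$; for $x,\bar x\in\mathbb H^n$ one has $x^{\mathfrak t}\bar x\le-1$. Let $\mathsf c$ be a $C^4$ function on an open subset $\mathcal N$ of $\mathcal M\times\bar{\mathcal M}$, with $\mathcal M,\bar{\mathcal M}$ manifolds of the same dimension. The Kim-McCann pairing on $T\mathcal N$ is $\langle(\omega_1,\bar\omega_1),(\omega_2,\bar\omega_2)\rangle_{KM}=-\frac12(D_{\omega_1}\bar D_{\bar\omega_2}\mathsf c+\bar D_{\bar\omega_1}D_{\omega_2}\mathsf c)$, where $D$, $\bar D$ denote directional derivatives in the first and second variable; it is required to be nondegenerate. In local coordinates $x^i$ on $\mathcal M$ and $\bar x^{j}$ on $\bar{\mathcal M}$, with unbarred (barred) subscripts of $\mathsf c$ denoting partial derivatives in $x$ (in $\bar x$) and $(\mathsf c^{a\bar f})$ the inverse of the matrix $(\mathsf c_{a\bar f})$ (i.e. $\sum_f\mathsf c^{a\bar f}\mathsf c_{b\bar f}=\delta^a_b$), the cross-curvature (MTW tensor) at $\mathring\omega=(\omega,\bar\omega)$ is $$\mathrm{cross}(\mathring\omega)=\frac12\sum_{i,l,j,k}\omega^i\omega^l\bar\omega^{j}\bar\omega^{k}\Big(\sum_{a,f}\mathsf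 c_{il\bar f}\,\mathsf c^{a\bar f}\,\mathsf c_{a\bar j\bar k}-\mathsf c_{il\bar j\bar k}\Big),$$ which does not depend on the coordinates. A tangent vector $\mathring\omega=(\omega,\bar\omega)$ is null if $\langle\mathring\omega,\mathring\omega\rangle_{KM}=0$. A3w: $\mathrm{cross}(\mathring\omega)\ge0$ for every null vector at every point of $\mathcal N$. A3s: A3w holds, and $\mathrm{cross}(\mathring\omega)=0$ for a null vector implies $\omega=0$ or $\bar\omega=0$. Here $\mathcal M=\bar{\mathcal M}=\mathbb H^n$ and $\mathcal N=\mathbb H^n\times\mathbb H^n$. *)

(* Defs.v *)
(* MathComp-Analysis, over an arbitrary [R : realType]. *)
From HB Require Import structures.
From mathcomp Require Import all_boot all_order all_algebra.
From mathcomp Require Import all_classical all_reals all_analysis.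
Set Implicit Arguments.
Unset Strict Implicit.
Unset Printing Implicit Defensive.
Import Order.TTheory GRing.Theory Num.Theory.
Import numFieldNormedType.Exports.
Local Open Scope classical_set_scope.
Local Open Scope ring_scope.

Section Hyperboloid.
Context {R : realType} {n : nat}.

Definition lorentz (x y : 'rV[R]_n.+1) : R :=
  - (x 0 ord0 * y 0 ord0) + \sum_(i < n) x 0 (lift ord0 i) * y 0 (lift ord0 i).

Definition hyperboloid : set 'rV[R]_n.+1 :=
  [set x | lorentz x x = -1 /\ 0 < x 0 ord0].

(* The coordinates x_1, ..., x_n form a global smooth chart of the hyperboloid
   (see [hparam_hyperboloid], [hcoordK] and [hparamK]). *)
Definition hcoord (x : 'rV[R]_n.+1) : 'rV[R]_n := \row_i x 0 (lift ord0 i).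

Definition hparam (z : 'rV[R]_n) : 'rV[R]_n.+1 :=
  \row_i if unlift ord0 i is Some j then z 0 j
         else Num.sqrt (1 + \sum_(k < n) z 0 k ^+ 2).

Lemma hparam0 z : hparam z 0 ord0 = Num.sqrt (1 + \sum_(k < n) z 0 k ^+ 2).
Proof. by rewrite mxE unlift_none. Qed.

Lemma hparamS z j : hparam z 0 (lift ord0 j) = z 0 j.
Proof. by rewrite mxE liftK. Qed.

Lemma hparam_hyperboloid z : hyperboloid (hparam z).
Proof.
have s0 : 0 < 1 + \sum_(k < n) z 0 k ^+ 2.
  by rewrite ltr_wpDr// sumr_ge0// => k _; rewrite sqr_ge0.
split; last by rewrite hparam0 sqrtr_gt0.
rewrite /lorentz hparam0 -expr2 sqr_sqrtr ?ltW//.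
have -> : \sum_(i < n) hparam z 0 (lift ord0 i) * hparam z 0 (lift ord0 i)
    = \sum_(k < n) z 0 k ^+ 2.
  by apply: eq_bigr => k _; rewrite hparamS expr2.
by rewrite opprD -addrA addNr addr0.
Qed.

Lemma hcoordK : cancel hparam hcoord.
Proof. by move=> z; apply/rowP => j; rewrite mxE hparamS. Qed.

Lemma hparamK : {in hyperboloid, cancel hcoord hparam}.
Proof.
move=> x /set_mem[xx x0]; apply/rowP => i.
have [j ->|->] := unliftP ord0 i; first by rewrite hparamS mxE.
rewrite hparam0; under eq_bigr do rewrite mxE expr2.
suff -> : 1 + \sum_(k < n) x 0 (lift ord0 k) * x 0 (lift ord0 k)
    = x 0 ord0 ^+ 2 by rewrite sqrtr_sqr gtr0_norm.
have -> : 1 = - lorentz x x by rewrite xx opprK.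
by rewrite /lorentz opprD opprK -addrA addNr addr0 expr2.
Qed.

End Hyperboloid.

Section CrossCurvature.
Context {R : realType}.

(* In finite dimension this is C^k regularity on the whole space [V]. *)
Fixpoint class_C {V : normedModType R} (k : nat) (f : V -> R) : Prop :=
  if k is k'.+1 then
    (forall x, differentiable f x) /\ (forall v, class_C k' (fun x => 'D_v f x))
  else continuous f.

Section Coordinates.
Context {n : nat}.
Implicit Types (c : 'rV[R]_n -> 'rV[R]_n -> R) (z zb w wb : 'rV[R]_n).

Definition Dl w c z zb : R := 'D_w (fun z' => c z' zb) z.
Definition Dr wb c z zb : R := 'D_wb (c z) zb.

Local Notation "''d_' i" := (Dl (delta_mx 0 i)) (at level 8, i at level 2).
Local Notation "''db_' j" := (Dr (delta_mx 0 j)) (at level 8, j at level 2).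

Definition KM_coord c z zb (v1 v2 : 'rV[R]_n * 'rV[R]_n) : R :=
  - (1 / 2) * (Dl v1.1 (Dr v2.2 c) z zb + Dr v1.2 (Dl v2.1 c) z zb).

Definition mixed_hessian c z zb : 'M[R]_n := \matrix_(a, f) 'd_a ('db_f c) z zb.

(* c^{a fbar}: sum_f c^{a fbar} c_{b fbar} = delta^a_b reads [P *m H^T = 1]. *)
Definition mixed_hessian_inv c z zb : 'M[R]_n := invmx (mixed_hessian c z zb)^T.

Definition cross_coord c z zb (v : 'rV[R]_n * 'rV[R]_n) : R :=
  1 / 2 * \sum_(i < n) \sum_(l < n) \sum_(j < n) \sum_(k < n)
    v.1 0 i * v.1 0 l * v.2 0 j * v.2 0 k *
    (\sum_(a < n) \sum_(f < n)
        'd_i ('d_l ('db_f c)) z zb * mixed_hessian_inv c z zb a f *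
        'd_a ('db_j ('db_k c)) z zb
     - 'd_i ('d_l ('db_j ('db_k c))) z zb).

End Coordinates.

Section OnHyperboloid.
Context {n : nat}.
Implicit Types (c : 'rV[R]_n.+1 -> 'rV[R]_n.+1 -> R) (x xb : 'rV[R]_n.+1).
Implicit Types v : 'rV[R]_n * 'rV[R]_n.

(* [KM] is invariant and [cross] is independent of the coordinates, so both are
   computed in the global chart; a tangent vector at [(x, xb)] is the pair of
   its coordinate vectors in that chart. *)
Definition in_chart c (z zb : 'rV[R]_n) : R := c (hparam z) (hparam zb).

Definition KM c x xb v1 v2 : R :=
  KM_coord (in_chart c) (hcoord x) (hcoord xb) v1 v2.

Definition cross c x xb v : R :=
  cross_coord (in_chart c) (hcoord x) (hcoord xb) v.

Definition null_vector c x xb v : Prop := KM c x xb v v = 0.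

(* Standing assumptions on a cost: C^4, with nondegenerate pairing. *)
Definition admissible_cost c : Prop :=
  class_C 4 (fun p : 'rV[R]_n * 'rV[R]_n => in_chart c p.1 p.2) /\
  forall x xb, hyperboloid x -> hyperboloid xb ->
    forall v1, (forall v2, KM c x xb v1 v2 = 0) -> v1 = 0.

Definition A3w c : Prop :=
  admissible_cost c /\
  forall x xb, hyperboloid x -> hyperboloid xb ->
    forall v, null_vector c x xb v -> 0 <= cross c x xb v.

Definition A3s c : Prop :=
  A3w c /\
  forall x xb, hyperboloid x -> hyperboloid xb ->
    forall v, null_vector c x xb v -> cross c x xb v = 0 ->
      v.1 = 0 \/ v.2 = 0.

End OnHyperboloid.
End CrossCurvature.

Section InverseCosts.
Context {R : realType}.

(* The inverse of the restriction of [s] to [I]; it is a genuine inverse on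
   [s @` I] when [s] is injective on [I], and is 0 outside [s @` I]. *)
Definition inverse_on (I : set R) (s : R -> R) : R -> R :=
  'pinv_(fun=> 0) I s.

Definition inner_cost (n : nat) (u : R -> R) (x xb : 'rV[R]_n.+1) : R :=
  u (lorentz x xb).

(* W_0 (y) is the w >= -1 with w e^w = y. *)
Definition LambertW0 : R -> R :=
  inverse_on `[-1, +oo[%classic (fun w => w * expR w).

End InverseCosts.

(* Main.v *)
(* For s solving s'' = mu s' - nu s, the inverse u satisfies a first order system
   with V(t) = s'(u(t)): u' = 1/V and V' = mu - nu t/V. All derivatives of the cost
   up to order four are thus rational in t and V. Writing w for a tangent vector
   both in the chart and in the ambient space, the non-tensorial part of the second
   derivative of the chart drops out of the MTW tensor, and the mixed Hessian is
   inverted on the plane spanned by x, xb and on its complement. With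
   a = <w, xb>, b = <x, wb>, t = <x, xb>, on null vectors everything factors:
     cross = - (q / (2 V N)) (|w|^2 + (nu/V^2) a^2) (|wb|^2 + (nu/V^2) b^2),
   where q = s'^2 - s s'' and N = t q + s''. In the listed cases q > 0, V > 0 and
   N < 0 for t <= -1, while a^2 <= |w|^2 (t^2 - 1) makes both factors positive as
   soon as V^2 + nu (t^2 - 1) > 0; the last logarithmic cost has q = 0. The C^4
   regularity follows by bootstrapping the first order system. *)
Require Import Defs.
From HB Require Import structures.
From mathcomp Require Import all_boot all_order all_algebra.
From mathcomp Require Import all_classical all_reals all_analysis.
From mathcomp Require Import ring lra.
Set Implicit Arguments.
Unset Strict Implicit.
Unset Printing Implicit Defensive.
Import Order.TTheory GRing.Theory Num.Theory.
Import numFieldNormedType.Exports.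
Local Open Scope classical_set_scope.
Local Open Scope ring_scope.

(** * Smooth functions *)

Section DirectionalChainRule.
Context {R : realType} {V : normedModType R}.
Implicit Types (f : V -> R) (g : R -> R).

Lemma derive_line f a v : 'D_v f a = 'D_1 (fun h : R => f (h *: v + a)) 0.
Proof.
rewrite /derive; set G := fun h => _; set H := fun h => _ *: ((_ \o shift 0) _ - _).
suff -> : G = H by [].
apply/funext => h; rewrite /G /H /=.
by rewrite addr0 scale0r add0r [_%:A]mulr1.
Qed.

(** Restricting [f] to the line through [a] with direction [v] reduces this to the one-variable
    chain rule, so only directional derivability of [f] is asked. *)
Lemma is_derive_chain f g a v (df dg : R) :
  is_derive a v f df -> is_derive (f a) 1 g dg ->
  is_derive a v (g \o f) (dg * df).
Proof.
move=> [fD fE] gD.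
have lD : is_derive (0 : R) 1 (fun h : R => f (h *: v + a)) df.
  by split; [exact: (iffLR (derivable1P f a v) fD) | rewrite -derive_line].
have lg : is_derive (f ((0 : R) *: v + a)) 1 g dg by rewrite scale0r add0r.
have [cD cE] := is_derive1_comp lg lD.
by split; [exact: (iffRL (derivable1P (g \o f) a v) cD) | rewrite derive_line; exact: cE].
Qed.

End DirectionalChainRule.

Section Smooth.
Context {R : realType} {V : normedModType R}.
Implicit Types (f : V -> R) (k : nat).

Definition smooth f := forall k, class_C k f.

Lemma class_C_differentiable k f x : class_C k.+1 f -> differentiable f x.
Proof. by case. Qed.

Lemma class_CW k f : class_C k.+1 f -> class_C k f.
Proof.
elim: k f => [|k IH] f [fd fD].
  by move=> x; exact/differentiable_continuous.
by split=> // v; apply: IH; exact: fD.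
Qed.

(** The regularity hypothesis on the derivatives raises the order of [f] by one, so induction on [k]
    reaches every order. *)
Lemma class_C_bootstrap f : (forall x, differentiable f x) ->
  (forall k, class_C k f -> forall v, class_C k (fun x => 'D_v f x)) ->
  smooth f.
Proof.
move=> fd fD; elim=> [|k IH]; last by split=> // v; exact: fD.
by move=> x; exact/differentiable_continuous.
Qed.

Lemma class_C_cst k (a : R) : class_C k (cst a : V -> R).
Proof.
elim: k a => [|k IH] a; first by move=> x; exact: cst_continuous.
split=> [x|v]; first exact: differentiable_cst.
by under [X in class_C k X]eq_fun do rewrite derive_cst; exact: IH.
Qed.

Lemma class_CD k f g : class_C k f -> class_C k g -> class_C k (f + g).
Proof.
elim: k f g => [|k IH] f g.
  by move=> fc gc x; apply: continuousD; [exact: fc | exact: gc].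
move=> [fd fD] [gd gD]; split=> [x|v]; first exact: differentiableD.
rewrite (_ : (fun x => _) = (fun x => 'D_v f x) + (fun x => 'D_v g x)).
  by apply: IH; [exact: fD | exact: gD].
by apply/funext => x; rewrite deriveD//; exact: diff_derivable.
Qed.

Lemma class_CM k f g : class_C k f -> class_C k g -> class_C k (f * g).
Proof.
elim: k f g => [|k IH] f g.
  by move=> fc gc x; apply: continuousM; [exact: fc | exact: gc].
move=> fk gk; have [[fd fD] [gd gD]] := (fk, gk).
split=> [x|v]; first exact: differentiableM.
rewrite (_ : (fun x => _) = f * (fun x => 'D_v g x) + g * (fun x => 'D_v f x)).
  by apply: class_CD; apply: IH; [exact: class_CW | exact: gD
                                 | exact: class_CW | exact: fD].
by apply/funext => x; rewrite deriveM//; exact: diff_derivable.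
Qed.

Lemma class_CN k f : class_C k f -> class_C k (- f).
Proof.
move=> fk; rewrite (_ : - f = cst (-1) * f); last first.
  by apply/funext => x; rewrite !fctE mulN1r.
by apply: class_CM => //; exact: class_C_cst.
Qed.

Lemma class_C_sum k m (F : 'I_m -> V -> R) :
  (forall i, class_C k (F i)) -> class_C k (\sum_(i < m) F i).
Proof.
move=> Fk; elim/big_ind : _ => //; first exact: class_C_cst.
by move=> f g; exact: class_CD.
Qed.

(** Bootstrapping for g' = g1: the derivative of [g \o f] along [v] is [g1 \o f] times that of [f],
    hence as regular as [g \o f] itself. It serves for the square root, for [V] and for [u]. *)
Lemma smooth_comp (g g1 : R -> R) f : smooth f ->
  (forall x, is_derive (f x) 1 g (g1 (f x))) ->
  (forall k, class_C k (g \o f) -> class_C k (g1 \o f)) -> smooth (g \o f).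
Proof.
move=> fs gD g1C; have fd x : differentiable f x.
  exact: class_C_differentiable (fs 1).
apply: class_C_bootstrap => [x|k gk v].
  apply: differentiable_comp => //.
  by apply/derivable1_diffP; case: (gD x).
rewrite (_ : (fun x => _) = (g1 \o f) * (fun x => 'D_v f x)).
  by apply: class_CM; [exact: g1C | case: (fs k.+1) => _; exact].
apply/funext => x.
have /derivableP fDx : derivable f x v by exact: diff_derivable.
by have [_ ->] := is_derive_chain fDx (gD x).
Qed.

(** The derivative of 1/f is -(1/f)^2 f', and the induction hypothesis controls 1/f at one order
    less. *)
Lemma class_CV k f : (forall x, f x != 0) -> class_C k f ->
  class_C k (GRing.inv \o f).
Proof.
move=> f0; elim: k => [fc x|k IH fk].
  by apply: continuousV; [exact: f0 | exact: fc].
split=> [x|v].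
  by apply: differentiableV; [exact: class_C_differentiable fk | exact: f0].
have fVk := IH (class_CW fk); have [fd /(_ v) fD] := fk.
rewrite (_ : (fun x => _) =
    - ((GRing.inv \o f) * (GRing.inv \o f)) * (fun x => 'D_v f x)).
  by apply: class_CM => //; apply/class_CN; exact: class_CM.
apply/funext => x; rewrite deriveV//; last exact: diff_derivable.
by rewrite !fctE /= -[_ *: _]/(_ * _) -exprVn expr2.
Qed.

Lemma smooth_sqrt f : smooth f -> (forall x, 0 < f x) -> smooth (Num.sqrt \o f).
Proof.
move=> fs f0; apply: (@smooth_comp _ (fun y => (2 * Num.sqrt y)^-1)) => // [x|k gk].
  exact: is_derive1_sqrt.
apply: (@class_CV k (cst 2 * (Num.sqrt \o f))).
  by move=> x; rewrite !fctE /= mulf_neq0// gt_eqF ?sqrtr_gt0.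
by apply: class_CM => //; exact: class_C_cst.
Qed.

Lemma is_derive_linear (f : V -> R) a v : linear f -> continuous f ->
  is_derive a v f (f v).
Proof.
(* Packing [f] as a bundled linear map gives access to the differential of a continuous linear
   map. *)
move=> lf cf; pose F : {linear V -> R} := HB.pack f (GRing.isLinear.Build _ _ _ _ f lf).
have Fd : differentiable F a by exact: linear_differentiable.
by split; [exact: diff_derivable | rewrite (@deriveE _ _ _ F)// diff_lin].
Qed.

Lemma smooth_linear (f : V -> R) : linear f -> continuous f -> smooth f.
Proof.
move=> lf cf; pose F : {linear V -> R} := HB.pack f (GRing.isLinear.Build _ _ _ _ f lf).
apply: class_C_bootstrap => [x|k _ v].
  exact: (@linear_differentiable _ _ _ F x cf).
rewrite (_ : (fun x => _) = cst (f v)); first exact: class_C_cst.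
by apply/funext => x; have [_ ->] := is_derive_linear x v lf cf.
Qed.

End Smooth.

(** * The graph chart of the hyperboloid *)

Section HyperboloidCalculus.
Context {R : realType} {n : nat}.
Implicit Types (z w v : 'rV[R]_n) (X Y : 'rV[R]_n.+1).

Definition dot v w : R := \sum_(i < n) v 0 i * w 0 i.

(** Time component first, so that chart, differential and second derivative share one shape. *)
Definition hvec (a : R) v : 'rV[R]_n.+1 :=
  \row_i if unlift ord0 i is Some j then v 0 j else a.

Definition rad z : R := Num.sqrt (1 + dot z z).

Lemma hvec0 a v : hvec a v 0 ord0 = a.
Proof. by rewrite mxE unlift_none. Qed.

Lemma hvecS a v j : hvec a v 0 (lift ord0 j) = v 0 j.
Proof. by rewrite mxE liftK. Qed.

Lemma hparam_hvec z : hparam z = hvec (rad z) z.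
Proof. by apply/rowP => i; rewrite !mxE /rad /dot; under eq_bigr do rewrite expr2. Qed.

Lemma dot_ge0 v : 0 <= dot v v.
Proof. by apply: sumr_ge0 => i _; rewrite -expr2 sqr_ge0. Qed.

Lemma dotC v w : dot v w = dot w v.
Proof. by apply: eq_bigr => i _; rewrite mulrC. Qed.

Lemma dotDZl a v v' w : dot (a *: v + v') w = a * dot v w + dot v' w.
Proof.
rewrite /dot mulr_sumr -big_split /=; apply: eq_bigr => i _.
by rewrite !mxE mulrDl mulrA.
Qed.

Lemma dotDZr a v w w' : dot v (a *: w + w') = a * dot v w + dot v w'.
Proof. by rewrite dotC dotDZl !(dotC v). Qed.

Lemma dot_eq0 v : dot v v = 0 -> v = 0.
Proof.
move=> /eqP; rewrite psumr_eq0 => [/allP v0|i _]; last by rewrite -expr2 sqr_ge0.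
apply/rowP => i; rewrite mxE; apply/eqP.
by have := v0 i (mem_index_enum i); rewrite /= mulf_eq0 orbb.
Qed.

Lemma dot_CauchySchwarz v w : dot v w ^+ 2 <= dot v v * dot w w.
Proof.
have [w0|wn0] := eqVneq w 0.
  rewrite w0 [dot v 0]big1 ?expr0n/= ?mulr_ge0 ?dot_ge0// => i _.
  by rewrite mxE mulr0.
have wp : 0 < dot w w by rewrite lt0r dot_ge0 andbT; apply: contra_neq wn0 => /dot_eq0.
(* The component of [v] orthogonal to [w] has nonnegative square. *)
have := dot_ge0 (- (dot v w / dot w w) *: w + v).
rewrite dotDZl !dotDZr (dotC w v) -(pmulr_rge0 _ wp).
suff -> : dot w w * (- (dot v w / dot w w) * (- (dot v w / dot w w) * dot w w + dot v w)
    + (- (dot v w / dot w w) * dot v w + dot v v)) =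
    dot v v * dot w w - dot v w ^+ 2 by rewrite subr_ge0.
by field; rewrite gt_eqF.
Qed.

Lemma rad_sqr z : rad z ^+ 2 = 1 + dot z z.
Proof. by rewrite sqr_sqrtr// addr_ge0// dot_ge0. Qed.

Lemma rad_gt0 z : 0 < rad z.
Proof. by rewrite sqrtr_gt0 ltr_wpDr// dot_ge0. Qed.

Lemma rad_neq0 z : rad z != 0.
Proof. by rewrite gt_eqF ?rad_gt0. Qed.

(** The differential of [hparam] at [z] in the direction [w], an ambient vector. *)
Definition dhparam z w := hvec (dot z w / rad z) w.

(** The second derivative of [hparam]; its space part vanishes because the space coordinates are
    linear in the chart. *)
Definition d2hparam z w w' :=
  hvec (dot w w' / rad z - dot z w * dot z w' / rad z ^+ 3) 0.

Lemma lorentz_hvec a v b w : lorentz (hvec a v) (hvec b w) = dot v w - a * b.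
Proof.
rewrite /lorentz !hvec0 addrC; congr (_ - _).
by apply: eq_bigr => i _; rewrite !hvecS.
Qed.

Lemma lorentzC X Y : lorentz X Y = lorentz Y X.
Proof.
rewrite /lorentz mulrC; congr (_ + _); apply: eq_bigr => i _; exact: mulrC.
Qed.

Lemma lorentzDZl a X X' Y : lorentz (a *: X + X') Y = a * lorentz X Y + lorentz X' Y.
Proof.
rewrite /lorentz !mxE mulrDr addrACA mulr_sumr -big_split /=; congr (_ + _).
  by rewrite mulrDl opprD mulrN mulrA.
by apply: eq_bigr => i _; rewrite !mxE mulrDl mulrA.
Qed.

Lemma lorentzDZr a X Y Y' : lorentz X (a *: Y + Y') = a * lorentz X Y + lorentz X Y'.
Proof. by rewrite lorentzC lorentzDZl !(lorentzC X). Qed.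

Lemma hvec_hcoord X : hvec (X 0 ord0) (hcoord X) = X.
Proof.
by apply/rowP => i; have [j ->|->] := unliftP ord0 i; rewrite ?hvecS ?hvec0 ?mxE.
Qed.

(** By Cauchy-Schwarz the space part is at most |z||zb|, which is strictly below the product of the
    time components. *)
Lemma lorentz_hparam_lt0 z zb : lorentz (hparam z) (hparam zb) < 0.
Proof.
rewrite !hparam_hvec lorentz_hvec subr_lt0.
have r0 : 0 <= rad z * rad zb by rewrite mulr_ge0// ltW ?rad_gt0.
apply: le_lt_trans (ler_norm _) _.
rewrite -(ltr_pXn2r (n := 2)) ?nnegrE// real_normK ?num_real// exprMn !rad_sqr.
apply: le_lt_trans (dot_CauchySchwarz _ _) _.
have := dot_ge0 z; have := dot_ge0 zb; nra.
Qed.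

Lemma lorentz_hparam z : lorentz (hparam z) (hparam z) = -1.
Proof. by case: (hparam_hyperboloid z). Qed.

Lemma lorentz_hparam_dhparam z w : lorentz (hparam z) (dhparam z w) = 0.
Proof.
by rewrite hparam_hvec lorentz_hvec mulrC mulfVK ?rad_neq0// subrr.
Qed.

(** This is the derivative of the tangency relation between [hparam z] and [dhparam z w]. *)
Lemma lorentz_hparam_d2hparam z w w' :
  lorentz (hparam z) (d2hparam z w w') = - lorentz (dhparam z w) (dhparam z w').
Proof.
rewrite hparam_hvec !lorentz_hvec.
have -> : dot z 0 = 0 by rewrite /dot big1// => i _; rewrite mxE mulr0.
by field; rewrite rad_neq0.
Qed.

(** Orthogonality to the base point determines the time component, so any ambient vector of this
    kind can be used as a chart direction. *)
Lemma dhparam_hcoord z X : lorentz (hparam z) X = 0 -> dhparam z (hcoord X) = X.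
Proof.
rewrite -[X in lorentz _ X]hvec_hcoord hparam_hvec lorentz_hvec => /eqP.
rewrite subr_eq0 => /eqP zX; rewrite /dhparam zX mulrC mulKf ?rad_neq0//.
exact: hvec_hcoord.
Qed.

Lemma dhparam_linear z : linear (dhparam z).
Proof.
move=> a v w; apply/rowP => i.
have [j ->|->] := unliftP ord0 i; first by rewrite ?mxE !liftK !mxE.
by rewrite !mxE unlift_none dotDZr mulrDl mulrA.
Qed.

Lemma dhparam0 z : dhparam z 0 = 0.
Proof.
have := dhparam_linear z (-1) 0 0; rewrite scaler0 addr0 => ->.
by rewrite scaleN1r addNr.
Qed.

(** The difference of the two sides is |z|^2 |w|^2 - (z.w)^2. This bound makes the Lorentz form
    positive definite on tangent spaces. *)
Lemma dhparam_norm z w :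
  dot w w <= (1 + dot z z) * lorentz (dhparam z w) (dhparam z w).
Proof.
rewrite lorentz_hvec -rad_sqr.
have -> : rad z ^+ 2 * (dot w w - dot z w / rad z * (dot z w / rad z)) =
    rad z ^+ 2 * dot w w - dot z w ^+ 2 by field; rewrite rad_neq0.
rewrite rad_sqr; have := dot_CauchySchwarz z w; lra.
Qed.

Lemma dhparam_ge0 z w : 0 <= lorentz (dhparam z w) (dhparam z w).
Proof.
have r0 : 0 < 1 + dot z z by rewrite -rad_sqr exprn_gt0 ?rad_gt0.
by rewrite -(pmulr_rge0 _ r0) (le_trans (dot_ge0 w)) ?dhparam_norm.
Qed.

Lemma dhparam_eq0 z w : lorentz (dhparam z w) (dhparam z w) = 0 -> w = 0.
Proof.
move=> w0; apply/dot_eq0/eqP; rewrite eq_le dot_ge0 andbT.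
by rewrite (le_trans (dhparam_norm z w))// w0 mulr0.
Qed.

Lemma dhparam_gt0 z w : w != 0 -> 0 < lorentz (dhparam z w) (dhparam z w).
Proof.
move=> wn0; rewrite lt0r dhparam_ge0 andbT.
by apply: contra_neq wn0 => /dhparam_eq0.
Qed.

Lemma coord_linear i : linear (fun z => z 0 i : R).
Proof. by move=> a u v; rewrite !mxE. Qed.

Lemma is_derive_coord z w i : is_derive z w (fun z => z 0 i : R) (w 0 i).
Proof. by apply: is_derive_linear; [exact: coord_linear | exact: coord_continuous]. Qed.

Lemma dot_linear v : linear (dot^~ v).
Proof. by move=> a u w; exact: dotDZl. Qed.

Lemma dot_continuous v : continuous (dot^~ v).
Proof.
rewrite (_ : dot^~ v =
    \sum_(i < n) ((fun z : 'rV[R]_n => z 0 i : R) * cst (v 0 i))); last first.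
  by apply/funext => y; rewrite fct_sumE.
apply: (@class_C_sum _ _ 0) => i; apply: (@class_CM _ _ 0); last exact: class_C_cst.
exact: coord_continuous.
Qed.

Lemma is_derive_dotl z w v : is_derive z w (dot^~ v) (dot w v).
Proof. by apply: is_derive_linear; [exact: dot_linear | exact: dot_continuous]. Qed.

Lemma is_derive_dot_self z w : is_derive z w (fun z => dot z z) (2 * dot z w).
Proof.
rewrite (_ : (fun z => dot z z) = \sum_(i < n) ((fun z : 'rV[R]_n => z 0 i : R) *
    (fun z : 'rV[R]_n => z 0 i : R))); last first.
  by apply/funext => y; rewrite fct_sumE.
have -> : 2 * dot z w = \sum_(i < n) (z 0 i * w 0 i + z 0 i * w 0 i).
  by rewrite big_split /= -mulr2n mulr_natl.
apply: is_derive_sum => i.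
by apply: is_deriveM; exact: is_derive_coord.
Qed.

Lemma is_derive_rad z w : is_derive z w rad (dot z w / rad z).
Proof.
have r0 : 0 < 1 + dot z z by rewrite -rad_sqr exprn_gt0 ?rad_gt0.
have dz : is_derive z w (fun z => 1 + dot z z) (2 * dot z w).
  have := is_deriveD (is_derive_cst (1 : R) z w) (is_derive_dot_self z w).
  by rewrite add0r.
have <- : (2 * rad z)^-1 * (2 * dot z w) = dot z w / rad z.
  by field; exact: rad_neq0.
exact: is_derive_chain dz (is_derive1_sqrt r0).
Qed.

Lemma is_derive_lorentz_hparam z w Y :
  is_derive z w (fun z => lorentz (hparam z) Y) (lorentz (dhparam z w) Y).
Proof.
rewrite -(hvec_hcoord Y) lorentz_hvec; set y0 := Y 0 ord0; set y := hcoord Y.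
rewrite (_ : (fun z => _) = (dot^~ y) - y0 \*: rad); last first.
  by apply/funext => v; rewrite hparam_hvec lorentz_hvec !fctE /= [_ *: _]mulrC.
rewrite mulrC.
exact: is_deriveB (is_derive_dotl z w y) (is_deriveZ y0 (is_derive_rad z w)).
Qed.

Lemma is_derive_lorentz_dhparam z w v Y :
  is_derive z w (fun z => lorentz (dhparam z v) Y) (lorentz (d2hparam z v w) Y).
Proof.
rewrite -(hvec_hcoord Y) lorentz_hvec; set y0 := Y 0 ord0; set y := hcoord Y.
have dV : is_derive z w (fun z => (rad z)^-1) (- (rad z) ^- 2 * (dot z w / rad z)).
  rewrite -[_ ^- 2]mulr1 -mulNr.
  exact: is_derive_chain (is_derive_rad z w)
    (@is_deriveV R id (rad z) 1 1 (rad_neq0 z) (is_derive_id _ _)).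
rewrite (_ : (fun z => _) =
    cst (dot v y) + - y0 \*: (dot^~ v * (fun z => (rad z)^-1))); last first.
  apply/funext => u; rewrite lorentz_hvec !fctE.
  by rewrite -[(_ \*: _) u]/(_ * _) mulNr (mulrC y0).
have H := is_deriveD (is_derive_cst (dot v y) z w)
  (is_deriveZ (- y0) (is_deriveM (is_derive_dotl z w v) dV)).
apply: is_derive_eq H _; rewrite -![_ *: _]/(_ * _).
have -> : dot 0 y = 0 by rewrite /dot big1// => i _; rewrite mxE mul0r.
by rewrite (dotC w v); field; exact: rad_neq0.
Qed.

(** The function is a polynomial in the coordinates and the two time components, and these are
    square roots of positive polynomials. *)
Lemma smooth_lorentz_hparam :
  smooth (fun p : 'rV[R]_n * 'rV[R]_n => lorentz (hparam p.1) (hparam p.2)).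
Proof.
have s1 i : smooth (fun p : 'rV[R]_n * 'rV[R]_n => p.1 0 i : R).
  apply: smooth_linear; first by move=> a p q; rewrite !mxE.
  move=> p; apply: (@continuous_comp _ _ _ (@fst 'rV[R]_n 'rV[R]_n) (fun z => z 0 i : R)).
    exact: cvg_fst.
  exact: coord_continuous.
have s2 i : smooth (fun p : 'rV[R]_n * 'rV[R]_n => p.2 0 i : R).
  apply: smooth_linear; first by move=> a p q; rewrite !mxE.
  move=> p; apply: (@continuous_comp _ _ _ (@snd 'rV[R]_n 'rV[R]_n) (fun z => z 0 i : R)).
    exact: cvg_snd.
  exact: coord_continuous.
have sr (h : 'rV[R]_n * 'rV[R]_n -> 'rV[R]_n) : (forall i, smooth (fun p => h p 0 i)) ->
    smooth (rad \o h).
  move=> sh; apply: (@smooth_sqrt _ _ (fun p => 1 + dot (h p) (h p))) => [k|p]; last first.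
    by rewrite -rad_sqr exprn_gt0 ?rad_gt0.
  rewrite (_ : (fun p => _) =
    cst 1 + \sum_(i < n) ((fun p => h p 0 i : R) * (fun p => h p 0 i : R))); last first.
    by apply/funext => p; rewrite !fctE fct_sumE.
  apply: class_CD; first exact: class_C_cst.
  by apply: class_C_sum => i; apply: class_CM; exact: sh.
move=> k; rewrite (_ : (fun p => _) = \sum_(i < n) ((fun p : 'rV[R]_n * 'rV[R]_n => p.1 0 i : R) *
    (fun p => p.2 0 i : R)) + - ((rad \o fst) * (rad \o snd))); last first.
  by apply/funext => p; rewrite !hparam_hvec lorentz_hvec !fctE fct_sumE.
apply: class_CD; first by apply: class_C_sum => i; apply: class_CM; [exact: s1|exact: s2].
by apply/class_CN/class_CM; apply: sr => i.
Qed.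

End HyperboloidCalculus.

(** * Derivatives of the cost *)

Definition tau {R : realType} {n : nat} (z zb : 'rV[R]_n) : R :=
  lorentz (hparam z) (hparam zb).

(* Hiding the geometric scalars keeps [ring] and [field] from comparing them up
   to conversion. *)
Ltac hide_scalars :=
  repeat match goal with |- context [lorentz ?X ?Y] => generalize (lorentz X Y) end;
  repeat match goal with |- context [?g (tau ?z ?zb)] => generalize (g (tau z zb)) end;
  intros.

Section MixedDerivatives.
Context {R : realType} {n : nat}.
Implicit Types (z zb w wb e f : 'rV[R]_n) (X Y : 'rV[R]_n.+1).

(* Unlike [is_derive] this is not a class, so that the rules below are only
   applied explicitly. *)
Definition has_derive (U : normedModType R) (a v : U) (f : U -> R) (df : R) : Prop :=
  is_derive a v f df.

Lemma has_derive_mul (U : normedModType R) (f g : U -> R) a v df dg :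
  has_derive a v f df -> has_derive a v g dg ->
  has_derive a v (fun x => f x * g x) (df * g a + f a * dg).
Proof.
by move=> fD gD; rewrite addrC (mulrC df); exact: (@is_deriveM _ _ f g a v df dg).
Qed.

Lemma has_derive_add (U : normedModType R) (f g : U -> R) a v df dg :
  has_derive a v f df -> has_derive a v g dg ->
  has_derive a v (fun x => f x + g x) (df + dg).
Proof. by move=> fD gD; exact: (@is_deriveD _ _ _ f g a v df dg). Qed.

Lemma has_derive_scale (U : normedModType R) (g : U -> R) (k : R) a v dg :
  has_derive a v g dg -> has_derive a v (fun x => k * g x) (k * dg).
Proof. by move=> gD; exact: (@is_deriveZ _ _ _ g k a v dg). Qed.

Lemma has_derive_exp (f : R -> R) (t df : R) m : has_derive t 1 f df ->
  has_derive t 1 (fun x => f x ^+ m) (m%:R * f t ^+ m.-1 * df).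
Proof. by rewrite -exprfctE => fD; exact: (@is_deriveX _ _ f m t 1 df). Qed.

Lemma has_derive_eq (U : normedModType R) (f : U -> R) a v df df' :
  has_derive a v f df' -> df' = df -> has_derive a v f df.
Proof. by move=> ? <-. Qed.

Lemma has_deriveE (U : normedModType R) (f : U -> R) a v df :
  has_derive a v f df -> 'D_v f a = df.
Proof. by case. Qed.

(* [V t] stands for s' (u t), where u is the inverse of a solution s of
   s'' = mu s' - nu s. *)
Variables (u V : R -> R) (mu nu : R).

(** The second equation is V' = s''/s' at [u t]. The range t < 0 contains every value of the Lorentz
    product of two points. *)
Definition inverse_ode : Prop := forall t : R, t < 0 ->
  [/\ V t != 0, is_derive t 1 u (V t)^-1 & is_derive t 1 V (mu - nu * t / V t)].

Hypothesis ode : inverse_ode.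

(** This is s'' at [u t]. Below, [u1] to [u4] are the first four derivatives of [u] as polynomials
    in [scnd] and 1/V; the factors [- 1] and [- nu] are written as scalings so that the derivative
    rules match them. *)
Definition scnd t := mu * V t + - nu * t.
Definition u1 t := (V t)^-1.
Definition u2 t := - 1 * (scnd t * u1 t ^+ 3).
Definition u3 t :=
  3 * (scnd t ^+ 2 * u1 t ^+ 5) + (- mu * (scnd t * u1 t ^+ 4) + nu * u1 t ^+ 3).
Definition u4 t :=
  6 * scnd t * (mu * scnd t * u1 t - nu) * u1 t ^+ 5 - 15 * scnd t ^+ 3 * u1 t ^+ 7
  - mu * ((mu * scnd t * u1 t - nu) * u1 t ^+ 4 - 4 * scnd t ^+ 2 * u1 t ^+ 6)
  - 3 * nu * scnd t * u1 t ^+ 5.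

Lemma has_derive_u0 (t : R) : t < 0 -> has_derive t 1 u (u1 t).
Proof. by move=> /ode[]. Qed.

Lemma has_derive_scnd (t : R) : t < 0 ->
  has_derive t 1 scnd (mu * scnd t * u1 t - nu).
Proof.
move=> /ode[V0 _ VD]; apply: has_derive_eq.
  rewrite /scnd; apply: has_derive_add; apply: has_derive_scale; first exact: VD.
  exact: is_derive_id.
by rewrite /scnd /u1; field.
Qed.

Lemma has_derive_u1 (t : R) : t < 0 -> has_derive t 1 u1 (u2 t).
Proof.
move=> /ode[V0 _ VD]; have := is_deriveV V0 VD.
move=> H; apply: has_derive_eq H _.
by rewrite -![_ *: _]/(_ * _) /u2 /u1 /scnd; field.
Qed.

Lemma has_derive_u2 (t : R) : t < 0 -> has_derive t 1 u2 (u3 t).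
Proof.
move=> t0; apply: has_derive_eq.
  rewrite /u2; apply: has_derive_scale; apply: has_derive_mul; first exact: has_derive_scnd.
  by apply: has_derive_exp; exact: has_derive_u1.
by rewrite /u3 /u2 /=; ring.
Qed.

Lemma has_derive_u3 (t : R) : t < 0 -> has_derive t 1 u3 (u4 t).
Proof.
move=> t0; apply: has_derive_eq.
  rewrite /u3; apply: has_derive_add.
    apply: has_derive_scale; apply: has_derive_mul.
      by apply: has_derive_exp; exact: has_derive_scnd.
    by apply: has_derive_exp; exact: has_derive_u1.
  apply: has_derive_add; apply: has_derive_scale.
    apply: has_derive_mul; first exact: has_derive_scnd.
    by apply: has_derive_exp; exact: has_derive_u1.
  by apply: has_derive_exp; exact: has_derive_u1.
by rewrite /u4 /u2 /=; ring.
Qed.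

Lemma has_derive_tau (g g1 : R -> R) z zb w :
  (forall t : R, t < 0 -> has_derive t 1 g (g1 t)) ->
  has_derive z w (fun z => g (tau z zb))
    (g1 (tau z zb) * lorentz (dhparam z w) (hparam zb)).
Proof.
move=> gD; apply: is_derive_chain (is_derive_lorentz_hparam z w (hparam zb)) _.
exact/gD/lorentz_hparam_lt0.
Qed.

Lemma has_derive_taur (g g1 : R -> R) z zb w :
  (forall t : R, t < 0 -> has_derive t 1 g (g1 t)) ->
  has_derive zb w (fun zb => g (tau z zb))
    (g1 (tau z zb) * lorentz (hparam z) (dhparam zb w)).
Proof.
move=> gD; rewrite lorentzC /tau lorentzC.
by under eq_fun do rewrite lorentzC; exact: has_derive_tau.
Qed.

Lemma has_derive_lorentz_dhparamr z w v Y :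
  has_derive z w (fun z => lorentz Y (dhparam z v)) (lorentz Y (d2hparam z v w)).
Proof.
rewrite lorentzC; under eq_fun do rewrite lorentzC.
exact: is_derive_lorentz_dhparam.
Qed.

Local Notation cost := (in_chart (@inner_cost R n u)).

(** Here and below the derivatives are equalities of functions of both points, so that each can be
    rewritten under the next derivative. *)
Lemma DrE f : Dr f cost =
  fun z zb => u1 (tau z zb) * lorentz (hparam z) (dhparam zb f).
Proof.
apply/funext => z; apply/funext => zb; apply: has_deriveE.
exact: has_derive_taur has_derive_u0.
Qed.

Lemma DlDrE e f : Dl e (Dr f cost) = fun z zb =>
  u2 (tau z zb) * lorentz (dhparam z e) (hparam zb) *
    lorentz (hparam z) (dhparam zb f) +
  u1 (tau z zb) * lorentz (dhparam z e) (dhparam zb f).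
Proof.
rewrite DrE; apply/funext => z; apply/funext => zb; apply: has_deriveE.
apply: has_derive_mul; first exact: has_derive_tau has_derive_u1.
exact: is_derive_lorentz_hparam.
Qed.

Lemma DlDlDrE e' e f : Dl e' (Dl e (Dr f cost)) = fun z zb =>
  u3 (tau z zb) * lorentz (dhparam z e') (hparam zb) *
    lorentz (dhparam z e) (hparam zb) * lorentz (hparam z) (dhparam zb f) +
  u2 (tau z zb) * (lorentz (d2hparam z e e') (hparam zb) *
      lorentz (hparam z) (dhparam zb f) +
    lorentz (dhparam z e) (hparam zb) * lorentz (dhparam z e') (dhparam zb f) +
    lorentz (dhparam z e') (hparam zb) * lorentz (dhparam z e) (dhparam zb f)) +
  u1 (tau z zb) * lorentz (d2hparam z e e') (dhparam zb f).
Proof.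
rewrite DlDrE; apply/funext => z; apply/funext => zb; apply: has_deriveE.
apply: has_derive_eq.
  apply: has_derive_add; apply: has_derive_mul.
  - apply: has_derive_mul; first exact: has_derive_tau has_derive_u2.
    exact: is_derive_lorentz_dhparam.
  - exact: is_derive_lorentz_hparam.
  - exact: has_derive_tau has_derive_u1.
  - exact: is_derive_lorentz_dhparam.
by cbv beta; hide_scalars; ring.
Qed.

Lemma DrDrE f' f : Dr f' (Dr f cost) = fun z zb =>
  u2 (tau z zb) * lorentz (hparam z) (dhparam zb f') *
    lorentz (hparam z) (dhparam zb f) +
  u1 (tau z zb) * lorentz (hparam z) (d2hparam zb f f').
Proof.
rewrite DrE; apply/funext => z; apply/funext => zb; apply: has_deriveE.
apply: has_derive_mul; first exact: has_derive_taur has_derive_u1.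
exact: has_derive_lorentz_dhparamr.
Qed.

Lemma DlDrDrE e f' f : Dl e (Dr f' (Dr f cost)) = fun z zb =>
  u3 (tau z zb) * lorentz (dhparam z e) (hparam zb) *
    lorentz (hparam z) (dhparam zb f') * lorentz (hparam z) (dhparam zb f) +
  u2 (tau z zb) * lorentz (dhparam z e) (dhparam zb f') *
    lorentz (hparam z) (dhparam zb f) +
  u2 (tau z zb) * lorentz (hparam z) (dhparam zb f') *
    lorentz (dhparam z e) (dhparam zb f) +
  (u2 (tau z zb) * lorentz (dhparam z e) (hparam zb) *
    lorentz (hparam z) (d2hparam zb f f') +
  u1 (tau z zb) * lorentz (dhparam z e) (d2hparam zb f f')).
Proof.
rewrite DrDrE; apply/funext => z; apply/funext => zb; apply: has_deriveE.
apply: has_derive_eq.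
  apply: has_derive_add; apply: has_derive_mul.
  - apply: has_derive_mul; first exact: has_derive_tau has_derive_u2.
    exact: is_derive_lorentz_hparam.
  - exact: is_derive_lorentz_hparam.
  - exact: has_derive_tau has_derive_u1.
  - exact: is_derive_lorentz_hparam.
by cbv beta; hide_scalars; ring.
Qed.

Lemma DlDlDrDrE e' e f' f : Dl e' (Dl e (Dr f' (Dr f cost))) = fun z zb =>
  u4 (tau z zb) * lorentz (dhparam z e') (hparam zb) *
    lorentz (dhparam z e) (hparam zb) *
    lorentz (hparam z) (dhparam zb f') * lorentz (hparam z) (dhparam zb f) +
  u3 (tau z zb) * (lorentz (d2hparam z e e') (hparam zb) *
      lorentz (hparam z) (dhparam zb f') * lorentz (hparam z) (dhparam zb f) +
    lorentz (dhparam z e) (hparam zb) * lorentz (dhparam z e') (dhparam zb f') *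
      lorentz (hparam z) (dhparam zb f) +
    lorentz (dhparam z e) (hparam zb) * lorentz (hparam z) (dhparam zb f') *
      lorentz (dhparam z e') (dhparam zb f) +
    lorentz (dhparam z e') (hparam zb) * lorentz (dhparam z e) (dhparam zb f') *
      lorentz (hparam z) (dhparam zb f) +
    lorentz (dhparam z e') (hparam zb) * lorentz (hparam z) (dhparam zb f') *
      lorentz (dhparam z e) (dhparam zb f) +
    lorentz (dhparam z e') (hparam zb) * lorentz (dhparam z e) (hparam zb) *
      lorentz (hparam z) (d2hparam zb f f')) +
  u2 (tau z zb) * (lorentz (d2hparam z e e') (dhparam zb f') *
      lorentz (hparam z) (dhparam zb f) +
    lorentz (dhparam z e) (dhparam zb f') * lorentz (dhparam z e') (dhparam zb f) +
    lorentz (dhparam z e') (dhparam zb f') * lorentz (dhparam z e) (dhparam zb f) +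
    lorentz (hparam z) (dhparam zb f') * lorentz (d2hparam z e e') (dhparam zb f) +
    lorentz (d2hparam z e e') (hparam zb) * lorentz (hparam z) (d2hparam zb f f') +
    lorentz (dhparam z e) (hparam zb) * lorentz (dhparam z e') (d2hparam zb f f') +
    lorentz (dhparam z e') (hparam zb) * lorentz (dhparam z e) (d2hparam zb f f')) +
  u1 (tau z zb) * lorentz (d2hparam z e e') (d2hparam zb f f').
Proof.
rewrite DlDrDrE; apply/funext => z; apply/funext => zb; apply: has_deriveE.
have d1 Y : has_derive z e' (fun z => lorentz (hparam z) Y) _ :=
  is_derive_lorentz_hparam z e' Y.
have d2 Y : has_derive z e' (fun z => lorentz (dhparam z e) Y) _ :=
  is_derive_lorentz_dhparam z e' e Y.
have D3 := @has_derive_tau _ _ z zb e' has_derive_u3.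
have D2 := @has_derive_tau _ _ z zb e' has_derive_u2.
have D1 := @has_derive_tau _ _ z zb e' has_derive_u1.
apply: has_derive_eq.
  apply: has_derive_add; first apply: has_derive_add; first apply: has_derive_add.
  - do 2![apply: has_derive_mul; last exact: d1].
    by apply: has_derive_mul; [exact: D3 | exact: d2].
  - apply: has_derive_mul; last exact: d1.
    by apply: has_derive_mul; [exact: D2 | exact: d2].
  - apply: has_derive_mul; last exact: d2.
    by apply: has_derive_mul; [exact: D2 | exact: d1].
  - apply: has_derive_add; apply: has_derive_mul.
    + by apply: has_derive_mul; [exact: D2 | exact: d2].
    + exact: d1.
    + exact: D1.
    + exact: d2.
by cbv beta; hide_scalars; ring.
Qed.

Lemma cost_sym zb : cost^~ zb = cost zb.
Proof. by apply/funext => z; rewrite /in_chart /inner_cost lorentzC. Qed.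

(** The cost is symmetric in its two points, so exchanging them turns one order of differentiation
    into the other. *)
Lemma Dr_Dl_sym e f z zb : Dr f (Dl e cost) z zb = Dl f (Dr e cost) zb z.
Proof.
have -> : Dr f (Dl e cost) z zb = 'D_f (Dl e cost z) zb by [].
have -> : Dl f (Dr e cost) zb z = 'D_f ((Dr e cost)^~ z) zb by [].
suff -> : Dl e cost z = (Dr e cost)^~ z by [].
by apply/funext => y; rewrite [LHS]/Dl cost_sym.
Qed.

End MixedDerivatives.

(** * The cross-curvature on null vectors *)

Section Multilinear.
Context {R : realType} {n : nat}.
Implicit Types (w b v e f : 'rV[R]_n).

Definition islin (g : 'rV[R]_n -> R) := forall a v w, g (a *: v + w) = a * g v + g w.

Lemma islin0 (g : 'rV[R]_n -> R) : islin g -> g 0 = 0.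
Proof. by move=> /(_ (-1) 0 0); rewrite scaler0 addr0 mulN1r addNr. Qed.

Lemma sum_islin (g : 'rV[R]_n -> R) w : islin g ->
  \sum_(i < n) w 0 i * g (delta_mx 0 i) = g w.
Proof.
move=> gl.
have gS (r : seq 'I_n) : g (\sum_(i <- r) w 0 i *: delta_mx 0 i) =
    \sum_(i <- r) w 0 i * g (delta_mx 0 i).
  elim: r => [|i r IH]; first by rewrite !big_nil islin0.
  by rewrite !big_cons gl IH.
by rewrite -gS -row_sum_delta.
Qed.

Lemma islin_sum (I : finType) (F : I -> 'rV[R]_n -> R) :
  (forall i, islin (F i)) -> islin (fun v => \sum_i F i v).
Proof.
by move=> Fl a v w; rewrite mulr_sumr -big_split; apply: eq_bigr => i _; exact: Fl.
Qed.

Lemma islinMr (g : 'rV[R]_n -> R) k : islin g -> islin (fun v => g v * k).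
Proof. by move=> gl a v w; rewrite gl mulrDl mulrA. Qed.

Lemma islinMl (g : 'rV[R]_n -> R) k : islin g -> islin (fun v => k * g v).
Proof. by move=> gl a v w; rewrite gl mulrDr mulrCA. Qed.

Lemma islinD (g h : 'rV[R]_n -> R) : islin g -> islin h -> islin (fun v => g v + h v).
Proof. by move=> gl hl a v w; rewrite gl hl; ring. Qed.

Lemma eq_islin (g h : 'rV[R]_n -> R) : g =1 h -> islin h -> islin g.
Proof. by move=> gh hl a v w; rewrite !gh. Qed.

Lemma islinB (g h : 'rV[R]_n -> R) : islin g -> islin h -> islin (fun v => g v - h v).
Proof. by move=> gl hl a v w; rewrite gl hl; ring. Qed.

(** Collapses the coordinate sum defining the cross-curvature to one evaluation on the vectors
    themselves. *)
Lemma sum_islin4 (G : 'rV[R]_n -> 'rV[R]_n -> 'rV[R]_n -> 'rV[R]_n -> R) w b :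
  (forall y z t, islin (fun x => G x y z t)) ->
  (forall x z t, islin (fun y => G x y z t)) ->
  (forall x y t, islin (fun z => G x y z t)) ->
  (forall x y z, islin (fun t => G x y z t)) ->
  \sum_(i < n) \sum_(l < n) \sum_(j < n) \sum_(k < n)
    w 0 i * w 0 l * b 0 j * b 0 k *
    G (delta_mx 0 i) (delta_mx 0 l) (delta_mx 0 j) (delta_mx 0 k) = G w w b b.
Proof.
move=> G1 G2 G3 G4.
rewrite -(sum_islin w (G1 w b b)); apply: eq_bigr => i _.
rewrite -(sum_islin w (G2 _ b b)) mulr_sumr; apply: eq_bigr => l _.
rewrite -(sum_islin b (G3 _ _ b)) !mulr_sumr; apply: eq_bigr => j _.
rewrite -(sum_islin b (G4 _ _ _)) !mulr_sumr; apply: eq_bigr => k _.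
by rewrite !mulrA.
Qed.

End Multilinear.

(** * Tangent vectors in the plane of the two base points *)

Section RadialVector.
Context {R : realType} {n : nat}.
Implicit Types (z zb w v : 'rV[R]_n) (X Y : 'rV[R]_n.+1).
Local Notation L := (@lorentz R n).

Lemma lorentz0l Y : L 0 Y = 0.
Proof.
have := lorentzDZl (-1) 0 0 Y; rewrite scaler0 addr0 => ->.
by rewrite mulN1r addNr.
Qed.

Lemma lorentzZl a X Y : L (a *: X) Y = a * L X Y.
Proof. by rewrite -[_ *: _]addr0 lorentzDZl lorentz0l addr0. Qed.

Lemma tau_lt0 z zb : tau z zb < 0.
Proof. exact: lorentz_hparam_lt0. Qed.

Lemma tauE z zb : L (hparam z) (hparam zb) = tau z zb.
Proof. by []. Qed.

Lemma tauC z zb : tau z zb = tau zb z.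
Proof. exact: lorentzC. Qed.

(* The vector orthogonal to [hparam z] in the plane of [hparam z], [hparam zb]. *)
Definition radial z zb := hparam zb + tau z zb *: hparam z.

Lemma lorentz_radial z zb Y : L (radial z zb) Y = L (hparam zb) Y + tau z zb * L (hparam z) Y.
Proof. by rewrite /radial addrC lorentzDZl addrC. Qed.

Lemma radial_tangent z zb : L (hparam z) (radial z zb) = 0.
Proof. by rewrite lorentzC lorentz_radial lorentz_hparam mulrN1 -/(tau zb z) tauC subrr. Qed.

Lemma radial_norm z zb : L (radial z zb) (radial z zb) = tau z zb ^+ 2 - 1.
Proof.
rewrite {1}lorentz_radial radial_tangent mulr0 addr0 lorentzC lorentz_radial.
by rewrite lorentz_hparam addrC expr2.
Qed.

(** The radial vector is tangent, so its square [tau z zb ^+ 2 - 1] is nonnegative, and [tau z zb]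
    is negative. *)
Lemma tau_le z zb : tau z zb <= -1.
Proof.
have := dhparam_ge0 z (hcoord (radial z zb)).
rewrite dhparam_hcoord ?radial_tangent// radial_norm.
by have := tau_lt0 z zb; nra.
Qed.

Lemma radial_CauchySchwarz z zb w :
  L (dhparam z w) (hparam zb) ^+ 2 <=
  L (dhparam z w) (dhparam z w) * (tau z zb ^+ 2 - 1).
Proof.
have [->|wn0] := eqVneq w 0.
  by rewrite dhparam0 !lorentz0l mul0r expr0n.
set W := L _ (dhparam z w); have W0 : 0 < W by exact: dhparam_gt0.
(* [v] is W times the component of the radial vector orthogonal to [dhparam z w]; its square is W (W
   (tau^2 - 1) - al^2). *)
set al := L _ _; pose v := W *: radial z zb + - al *: dhparam z w.
have vE Y : L v Y = W * L (radial z zb) Y - al * L (dhparam z w) Y.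
  by rewrite /v lorentzDZl lorentzZl mulNr.
have rX : L (radial z zb) (dhparam z w) = al.
  by rewrite lorentz_radial lorentz_hparam_dhparam mulr0 addr0 lorentzC.
have vt : L (hparam z) v = 0.
  rewrite lorentzC vE lorentzC radial_tangent (lorentzC (dhparam z w)).
  by rewrite lorentz_hparam_dhparam !mulr0 subr0.
have := dhparam_ge0 z (hcoord v); rewrite dhparam_hcoord// vE lorentzC vE.
rewrite (lorentzC _ v) vE radial_norm rX (lorentzC _ (radial z zb)) rX -/W => h.
by rewrite -subr_ge0 -(pmulr_rge0 _ W0); move: h; lra.
Qed.

Lemma d2hparamC z w w' : d2hparam z w w' = d2hparam z w' w.
Proof. by rewrite /d2hparam dotC (mulrC (dot z w)). Qed.

Lemma d2hparam_linear z w' : linear (d2hparam z ^~ w').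
Proof.
move=> a v w; apply/rowP => i; rewrite !mxE; case: unliftP => [j _|_].
  by rewrite !mxE mulr0 addr0.
by rewrite dotDZl dotDZr; ring.
Qed.

Lemma d2hparam_linear2 z w : linear (d2hparam z w).
Proof.
by move=> a v w'; rewrite !(d2hparamC z w); exact: d2hparam_linear.
Qed.

Lemma lorentz_dhparam_islin z Y : islin (fun w => L (dhparam z w) Y).
Proof. by move=> a v w; rewrite dhparam_linear lorentzDZl. Qed.

Lemma lorentz_dhparamr_islin z Y : islin (fun w => L Y (dhparam z w)).
Proof. by move=> a v w; rewrite dhparam_linear lorentzDZr. Qed.

Lemma lorentz_d2hparam_islin z w' Y : islin (fun w => L (d2hparam z w w') Y).
Proof. by move=> a v w; rewrite d2hparam_linear lorentzDZl. Qed.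

Lemma lorentz_d2hparam_islin2 z w Y : islin (fun w' => L (d2hparam z w w') Y).
Proof. by move=> a v w'; rewrite d2hparam_linear2 lorentzDZl. Qed.

Lemma lorentz_d2hparamr_islin z w' Y : islin (fun w => L Y (d2hparam z w w')).
Proof. by move=> a v w; rewrite d2hparam_linear lorentzDZr. Qed.

Lemma lorentz_d2hparamr_islin2 z w Y : islin (fun w' => L Y (d2hparam z w w')).
Proof. by move=> a v w'; rewrite d2hparam_linear2 lorentzDZr. Qed.

End RadialVector.

(** In a product the variable occurs in one factor only; unification with a constant factor decides
    which one. *)
Ltac prove_islin :=
  lazymatch goal with
  | |- islin (fun e => lorentz (dhparam _ e) _) => exact (lorentz_dhparam_islin _ _)
  | |- islin (fun e => lorentz _ (dhparam _ e)) => exact (lorentz_dhparamr_islin _ _)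
  | |- islin (fun e => lorentz (d2hparam _ e _) _) =>
      exact (lorentz_d2hparam_islin _ _ _)
  | |- islin (fun e => lorentz (d2hparam _ _ e) _) =>
      exact (lorentz_d2hparam_islin2 _ _ _)
  | |- islin (fun e => lorentz _ (d2hparam _ e _)) =>
      exact (lorentz_d2hparamr_islin _ _ _)
  | |- islin (fun e => lorentz _ (d2hparam _ _ e)) =>
      exact (lorentz_d2hparamr_islin2 _ _ _)
  | |- islin (fun e => @?g e + @?h e) => refine (@islinD _ _ g h _ _); prove_islin
  | |- islin (fun e => @?g e * @?h e) =>
      first [refine (@islinMl _ _ h _ _) | refine (@islinMr _ _ g _ _)]; prove_islin
  end.

(** * Nondegeneracy, the formula for the cross-curvature and the sign criteria *)

Section CrossFormula.
Context {R : realType} {n : nat}.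
Variables (u V : R -> R) (mu nu : R).
Hypothesis ode : inverse_ode u V mu nu.
Implicit Types (z zb w wb e f : 'rV[R]_n).

Local Notation cost := (in_chart (@inner_cost R n u)).
Local Notation L := (@lorentz R n).
Local Notation S := (scnd V mu nu).

Local Opaque hparam dhparam d2hparam lorentz tau.

(* In terms of s these are s'^2 - s s'' and s s'^2 - (s^2 - 1) s'' at [u t];
   [nondeg t / V t ^ 3] is the mixed Hessian evaluated at the two unit tangent
   vectors in the plane of the base points. *)
Definition wronskian t := V t ^+ 2 - t * S t.
Definition nondeg t := t * wronskian t + S t.

Lemma V_neq0 z zb : V (tau z zb) != 0.
Proof. by case: (ode (tau_lt0 z zb)). Qed.

Lemma hessianE z zb e f : Dl e (Dr f cost) z zb =
  (- S (tau z zb) * L (dhparam z e) (hparam zb) * L (hparam z) (dhparam zb f) +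
   V (tau z zb) ^+ 2 * L (dhparam z e) (dhparam zb f)) / V (tau z zb) ^+ 3.
Proof.
rewrite (DlDrE ode) /u2 /u1; move: (V_neq0 z zb); hide_scalars; by field.
Qed.

Lemma hessian_islin z zb f : islin (fun e => Dl e (Dr f cost) z zb).
Proof. by apply: eq_islin => [?|]; [rewrite (DlDrE ode); reflexivity | prove_islin]. Qed.

Lemma hessian_islin2 z zb e : islin (fun f => Dl e (Dr f cost) z zb).
Proof. by apply: eq_islin => [?|]; [rewrite (DlDrE ode); reflexivity | prove_islin]. Qed.

Lemma hessian_nondegenerate z zb w : nondeg (tau z zb) != 0 ->
  (forall f, Dl w (Dr f cost) z zb = 0) -> w = 0.
Proof.
move=> N0 H0; have V0 := V_neq0 z zb.
pose X := dhparam z w; pose t := tau z zb.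
have key Y : L (hparam zb) Y = 0 ->
    V t ^+ 2 * L X Y = S t * L X (hparam zb) * L (hparam z) Y.
  move=> Yt; have := H0 (hcoord Y); rewrite hessianE dhparam_hcoord// => /eqP.
  rewrite mulf_eq0 invr_eq0 expf_eq0/= (negbTE V0) orbF addrC !mulNr subr_eq0.
  by move=> /eqP.
(* Testing on the radial vector at [zb] gives [nondeg t] times this product equal to 0. *)
have al0 : L X (hparam zb) = 0.
  have := key (radial zb z) (radial_tangent _ _).
  rewrite !(lorentzC _ (radial zb z)) !lorentz_radial lorentz_hparam.
  rewrite (lorentzC (hparam z) X) (lorentzC X) lorentz_hparam_dhparam.
  rewrite (lorentzC (hparam zb) (hparam z)) tauE (tauC zb z) -/t add0r (lorentzC _ X) => h.
  have : nondeg t * L X (hparam zb) = 0.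
    by rewrite /nondeg /wronskian; move: h; hide_scalars; lra.
  by move/eqP; rewrite mulf_eq0 (negbTE N0) /= => /eqP.
(* By [al0] the vector [X] is also tangent at [zb], so [key] may be tested on [X] itself. *)
apply: (dhparam_eq0 (z := z)); apply/eqP.
have := key X; rewrite lorentzC al0 mulr0 mul0r => /(_ erefl)/eqP.
by rewrite mulf_eq0 expf_eq0/= (negbTE V0).
Qed.

Lemma mixed_hessian_unit z zb : nondeg (tau z zb) != 0 ->
  (mixed_hessian cost z zb)^T \in unitmx.
Proof.
move=> N0; rewrite unitmx_tr unitmxE unitfE; apply/negP => /det0P[v vn0 /rowP v0].
move/eqP: vn0; apply; apply: (hessian_nondegenerate N0) => f.
have Hf j : Dl v (Dr (delta_mx 0 j) cost) z zb = 0.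
  rewrite -(sum_islin v (hessian_islin z zb _)).
  by have := v0 j; rewrite !mxE => h; rewrite -[RHS]h; apply: eq_bigr => i _; rewrite mxE.
by rewrite -(sum_islin f (hessian_islin2 z zb v)) big1// => j _; rewrite Hf mulr0.
Qed.

(** The inverse matrix is never computed: a solution [e] of the linear system with right-hand side
    [Q] is what contracting [Q] with the inverse must return. *)
Lemma mixed_hessian_invP z zb (Q : 'I_n -> R) e : nondeg (tau z zb) != 0 ->
  (forall f : 'I_n, Dl e (Dr (delta_mx 0 f) cost) z zb = Q f) ->
  forall a, \sum_f Q f * mixed_hessian_inv cost z zb a f = e 0 a.
Proof.
move=> N0 HQ a.
have HM : (mixed_hessian cost z zb)^T *m e^T = \col_f Q f.
  apply/colP => f; rewrite !mxE -HQ -(sum_islin e (hessian_islin z zb _)).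
  by apply: eq_bigr => i _; rewrite !mxE mulrC.
have := congr1 (mulmx (mixed_hessian_inv cost z zb)) HM.
rewrite mulmxA mulVmx ?mixed_hessian_unit// mul1mx => /colP/(_ a); rewrite !mxE => ->.
by apply: eq_bigr => f _; rewrite !mxE mulrC.
Qed.

(** If [e] represents the third derivative along [w], [w] through the mixed Hessian, then the
    contraction with the inverse Hessian is the third derivative along [e], [wb], [wb]. *)
Lemma cross_coordE z zb w wb e : nondeg (tau z zb) != 0 ->
  (forall f, Dl e (Dr f cost) z zb = Dl w (Dl w (Dr f cost)) z zb) ->
  cross_coord cost z zb (w, wb) = 1 / 2 *
    (Dl e (Dr wb (Dr wb cost)) z zb - Dl w (Dl w (Dr wb (Dr wb cost))) z zb).
Proof.
move=> N0 He; rewrite /cross_coord /=; congr (_ * _).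
pose P := mixed_hessian_inv cost z zb.
pose G x y x' y' := \sum_(a < n) \sum_(f < n)
    Dl x (Dl y (Dr (delta_mx 0 f) cost)) z zb * P a f *
    Dl (delta_mx 0 a) (Dr x' (Dr y' cost)) z zb - Dl x (Dl y (Dr x' (Dr y' cost))) z zb.
(* The four goals after the main one are linearity in each slot. *)
have := @sum_islin4 R n G w wb; rewrite {1}/G => ->.
- rewrite /G; congr (_ - _).
  have Bl : islin (fun x => Dl x (Dr wb (Dr wb cost)) z zb).
    by apply: eq_islin => [?|]; [rewrite (DlDrDrE ode); reflexivity | prove_islin].
  rewrite -(sum_islin e Bl); apply: eq_bigr => a _; rewrite -mulr_suml; congr (_ * _).
  by apply: mixed_hessian_invP => // f; rewrite He.
- move=> y x' y'; apply: islinB.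
    do 2!apply: islin_sum => ?; do 2!apply: islinMr.
    by apply: eq_islin => [?|]; [rewrite (DlDlDrE ode); reflexivity | prove_islin].
  by apply: eq_islin => [?|]; [rewrite (DlDlDrDrE ode); reflexivity | prove_islin].
- move=> x x' y'; apply: islinB.
    do 2!apply: islin_sum => ?; do 2!apply: islinMr.
    by apply: eq_islin => [?|]; [rewrite (DlDlDrE ode); reflexivity | prove_islin].
  by apply: eq_islin => [?|]; [rewrite (DlDlDrDrE ode); reflexivity | prove_islin].
- move=> x y y'; apply: islinB.
    do 2!apply: islin_sum => ?; apply: islinMl.
    by apply: eq_islin => [?|]; [rewrite (DlDrDrE ode); reflexivity | prove_islin].
  by apply: eq_islin => [?|]; [rewrite (DlDlDrDrE ode); reflexivity | prove_islin].
- move=> x y x'; apply: islinB.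
    do 2!apply: islin_sum => ?; apply: islinMl.
    by apply: eq_islin => [?|]; [rewrite (DlDrDrE ode); reflexivity | prove_islin].
  by apply: eq_islin => [?|]; [rewrite (DlDlDrDrE ode); reflexivity | prove_islin].
Qed.

(* The chart enters only through [d2hparam], whose contributions cancel. *)
Lemma cross_null z zb w wb (t := tau z zb)
    (al := L (dhparam z w) (hparam zb)) (be := L (hparam z) (dhparam zb wb)) :
  nondeg t != 0 -> Dl w (Dr wb cost) z zb = 0 ->
  cross_coord cost z zb (w, wb) = - (wronskian t / (2 * V t * nondeg t)) *
    (L (dhparam z w) (dhparam z w) + nu / V t ^+ 2 * al ^+ 2) *
    (L (dhparam zb wb) (dhparam zb wb) + nu / V t ^+ 2 * be ^+ 2).
Proof.
move=> N0 H0; have V0 := V_neq0 z zb.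
set W := L (dhparam z w) (dhparam z w); set Wb := L (dhparam zb wb) (dhparam zb wb).
(* [Z] solves the system required by [cross_coordE]: [a] matches the coefficient of the product of
   the two differentials, [b] that of the product with [hparam z], and the rest is the tangential
   part of the second derivative of the chart. *)
pose a := - (2 * S t * al) / V t ^+ 2.
pose b := wronskian t * (nu * al ^+ 2 / V t ^+ 2 + W) / nondeg t.
pose Z := a *: dhparam z w + (b *: radial z zb + (d2hparam z w w + - W *: hparam z)).
have ZE Y : L Z Y = a * L (dhparam z w) Y +
    (b * (L (hparam zb) Y + t * L (hparam z) Y) + (L (d2hparam z w w) Y - W * L (hparam z) Y)).
  rewrite /Z !lorentzDZl lorentz_radial; congr (_ + (_ + _)).
  by rewrite addrC lorentzDZl mulNr addrC.
have xX : L (dhparam z w) (hparam z) = 0 by rewrite lorentzC lorentz_hparam_dhparam.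
have Zt : L (hparam z) Z = 0.
  rewrite lorentzC ZE xX lorentz_hparam (lorentzC (d2hparam _ _ _)).
  rewrite lorentz_hparam_d2hparam -/W tauE (tauC zb z) -/t; ring.
have zbX f : L (hparam zb) (dhparam zb f) = 0 by exact: lorentz_hparam_dhparam.
have dZ := dhparam_hcoord Zt.
(* Nullity expresses the product of the two tangent vectors through [al] and [be]. *)
have H0' : V t ^+ 2 * L (dhparam z w) (dhparam zb wb) = S t * al * be.
  move/eqP: H0; rewrite hessianE mulf_eq0 invr_eq0 expf_eq0/= (negbTE V0) orbF.
  by rewrite addrC !mulNr subr_eq0 => /eqP.
rewrite (@cross_coordE _ _ _ _ (hcoord Z)) => [|//|f].
- rewrite (DlDrDrE ode) (DlDlDrDrE ode) dZ !ZE lorentz_hparam.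
  rewrite tauE -/t -/al -/be !zbX lorentz_hparam_d2hparam -/Wb.
  have -> : L (dhparam z w) (dhparam zb wb) = S t * al * be / V t ^+ 2.
    by rewrite -H0' mulrAC divff ?mul1r// expf_eq0/= (negbTE V0).
  rewrite /a /b /u4 /u3 /u2 /u1.
  (* Eliminating [mu] leaves quantities that [field] may treat as independent. *)
  have muE : mu = (S t + nu * t) / V t by rewrite /scnd; field.
  move: muE N0 V0; rewrite /nondeg /wronskian -/t; clear; clearbody al be W Wb t.
  move: (S t) (V t) => s v ->; hide_scalars; field.
  by rewrite V0 N0.
- rewrite (DlDrE ode) (DlDlDrE ode) dZ !ZE lorentz_hparam zbX.
  rewrite tauE -/t -/al.
  rewrite /a /b /u3 /u2 /u1.
  have muE : mu = (S t + nu * t) / V t by rewrite /scnd; field.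
  move: muE N0 V0; rewrite /nondeg /wronskian -/t; clear; clearbody al W t.
  move: (S t) (V t) => s v ->; hide_scalars; field.
  by rewrite V0 N0.
Qed.

(** The equation for V' has a right-hand side as regular as [V], so [V] along the Lorentz product is
    smooth; then u' = 1/V makes the cost smooth. *)
Lemma smooth_cost : smooth (fun p : 'rV[R]_n * 'rV[R]_n => cost p.1 p.2).
Proof.
pose T (p : 'rV[R]_n * 'rV[R]_n) := tau p.1 p.2.
have T0 p : T p < 0 by exact: tau_lt0.
have Ts : smooth T by exact: smooth_lorentz_hparam.
have VT p : (V \o T) p != 0 by exact: V_neq0.
have Vs : smooth (V \o T).
  apply: (@smooth_comp _ _ V (fun t => mu - nu * t / V t)) => // [p|k Vk].
    by case: (ode (T0 p)).
  apply: (@class_CD _ _ k (cst mu) (- (cst nu * T * (GRing.inv \o (V \o T))))).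
    exact: class_C_cst.
  apply/class_CN/class_CM; last exact: class_CV.
  by apply: class_CM => //; exact: class_C_cst.
apply: (@smooth_comp _ _ u (u1 V) T) => // [p|k _]; first by case: (ode (T0 p)).
by apply: (@class_CV _ _ k (V \o T)) => //; exact: Vs.
Qed.

Lemma KM_coordE z zb v1 v2 : KM_coord cost z zb v1 v2 =
  - (1 / 2) * (Dl v1.1 (Dr v2.2 cost) z zb + Dl v1.2 (Dr v2.1 cost) zb z).
Proof. by rewrite /KM_coord Dr_Dl_sym. Qed.

(** By symmetry of the cost both terms of the pairing agree, and their combination is minus the
    mixed derivative. *)
Lemma KM_coord_null z zb w wb :
  KM_coord cost z zb (w, wb) (w, wb) = 0 -> Dl w (Dr wb cost) z zb = 0.
Proof.
rewrite KM_coordE /= (_ : Dl wb (Dr w cost) zb z = Dl w (Dr wb cost) z zb).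
  by lra.
by rewrite !hessianE (tauC zb z) !(lorentzC _ (dhparam z w)) (lorentzC (dhparam zb wb) (hparam z)) (mulrAC _ (L _ (hparam zb))).
Qed.

(** Pairing with (0, f) isolates [w], pairing with (f, 0) isolates [wb]; the second case is the
    first with the points exchanged. *)
Lemma inverse_ode_admissible : (forall t, t <= -1 -> nondeg t != 0) ->
  admissible_cost (@inner_cost R n u).
Proof.
move=> N0; split; first exact: smooth_cost.
move=> x xb _ _ [w wb] H; rewrite /KM in H.
have h0 : - (1 / 2) != 0 :> R by rewrite oppr_eq0 mulf_neq0.
congr (_, _).
- apply: (hessian_nondegenerate (N0 _ (tau_le (hcoord x) (hcoord xb)))) => f.
  have := H (0, f); rewrite KM_coordE /= (islin0 (hessian_islin2 _ _ _)) addr0.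
  by move=> /eqP; rewrite mulf_eq0 (negbTE h0) => /eqP.
- apply: (hessian_nondegenerate (N0 _ (tau_le (hcoord xb) (hcoord x)))) => f.
  have := H (f, 0); rewrite KM_coordE /= (islin0 (hessian_islin2 _ _ _)) add0r.
  by move=> /eqP; rewrite mulf_eq0 (negbTE h0) => /eqP.
Qed.

(** Only k < 0 is at stake; there Cauchy-Schwarz against the radial vector bounds the sum below by
    the squared norm times 1 + k (tau^2 - 1). *)
Lemma norm_factor_gt0 z zb w k : 0 < 1 + k * (tau z zb ^+ 2 - 1) -> w != 0 ->
  0 < L (dhparam z w) (dhparam z w) + k * L (dhparam z w) (hparam zb) ^+ 2.
Proof.
move=> k1 wn0; have W0 := @dhparam_gt0 R n z w wn0.
have CS := radial_CauchySchwarz z zb w.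
have a0 := sqr_ge0 (L (dhparam z w) (hparam zb)).
have [k0|k0] := leP 0 k; first by rewrite ltr_wpDr// mulr_ge0.
apply: lt_le_trans (_ : 0 < L (dhparam z w) (dhparam z w) * (1 + k * (tau z zb ^+ 2 - 1))) _.
  by rewrite mulr_gt0.
by rewrite mulrDr mulr1 lerD2l mulrCA ler_nM2l.
Qed.

Lemma inverse_ode_A3s :
  (forall t, t <= -1 -> [/\ 0 < V t, 0 < wronskian t, nondeg t < 0 &
    0 < V t ^+ 2 + nu * (t ^+ 2 - 1)]) ->
  A3s (@inner_cost R n u).
Proof.
move=> H; have N0 t : t <= -1 -> nondeg t != 0 by move=> /H[_ _ /lt_eqF->].
(* The fourth hypothesis divided by V^2. *)
have K1 z zb : 0 < 1 + nu / V (tau z zb) ^+ 2 * (tau z zb ^+ 2 - 1).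
  have [v0 _ _ h] := H _ (tau_le z zb).
  rewrite -(pmulr_rgt0 _ (exprn_gt0 2 v0)).
  move: (tau _ _) (V _) h v0 => t v h v0.
  rewrite [X in 0 < X](_ : _ = v ^+ 2 + nu * (t ^+ 2 - 1))//.
  by field; rewrite gt_eqF.
have main x xb w wb : null_vector (inner_cost u) x xb (w, wb) ->
    w != 0 -> wb != 0 -> 0 < cross (inner_cost u) x xb (w, wb).
  move=> /KM_coord_null nul wn0 wbn0.
  rewrite /cross cross_null//; last exact/N0/tau_le.
  have [v0 q0 n0 _] := H _ (tau_le (hcoord x) (hcoord xb)).
  apply: mulr_gt0; first apply: mulr_gt0.
  - rewrite oppr_gt0 pmulr_rlt0// invr_lt0 pmulr_rlt0//; exact: mulr_gt0.
  - exact: norm_factor_gt0.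
  - rewrite (lorentzC (hparam _) (dhparam _ _)) tauC; apply: norm_factor_gt0 => //.
have zero x xb w wb : null_vector (inner_cost u) x xb (w, wb) ->
    (w == 0) || (wb == 0) -> cross (inner_cost u) x xb (w, wb) = 0.
  move=> /KM_coord_null nul /orP w0.
  rewrite /cross cross_null//; last exact/N0/tau_le.
  case: w0 => /eqP->; rewrite dhparam0.
    by rewrite !lorentz0l expr0n /= mulr0 addr0 mulr0 mul0r.
  by rewrite (lorentzC _ 0) !lorentz0l expr0n /= mulr0 addr0 mulr0.
split.
  split; first exact: inverse_ode_admissible.
  move=> x xb _ _ [w wb] nul.
  have [w0|] := boolP ((w == 0) || (wb == 0)); first by rewrite zero.
  by rewrite negb_or => /andP[wn0 wbn0]; rewrite ltW// main.
move=> x xb _ _ [w wb] nul c0.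
have [/orP[]/eqP|] := boolP ((w == 0) || (wb == 0)); [by left|by right|].
by rewrite negb_or => /andP[wn0 wbn0]; have := main _ _ _ _ nul wn0 wbn0; rewrite c0 ltxx.
Qed.

Lemma inverse_ode_A3w :
  (forall t, t <= -1 -> wronskian t = 0 /\ nondeg t != 0) ->
  A3w (@inner_cost R n u).
Proof.
move=> H; split; first by apply: inverse_ode_admissible => t /H[].
move=> x xb _ _ [w wb] /KM_coord_null nul.
have [q0 n0] := H _ (tau_le (hcoord x) (hcoord xb)).
by rewrite /cross cross_null// q0 mul0r oppr0 !mul0r.
Qed.

End CrossFormula.

(** * The costs of the theorem *)

Section InverseBranch.
Context {R : realType}.
Variables (I : set R) (s s1 : R -> R) (u0 : R).
Hypothesis sD : forall v : R, has_derive v 1 s (s1 v).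
(** The slope is asked to be positive only strictly left of a point of [I], because it vanishes at
    the endpoint [uc] of the one-sided ranges. *)
Hypothesis I_down : forall a b, a < b -> I b -> I a /\ 0 < s1 a.
Hypothesis Iu0 : I u0.
Hypothesis su0 : 0 <= s u0.
Hypothesis s_Ny : forall t : R, t < 0 -> exists2 v, v <= u0 & s v <= t.

Local Notation u := (inverse_on I s).

Lemma branch_continuous : continuous s.
Proof.
move=> v; apply/differentiable_continuous/derivable1_diffP.
by case: (sD v).
Qed.

Lemma branch_increasing a b : a < b -> I b -> s a < s b.
Proof.
move=> ab Ib; have [|c /[!in_itv]/= /andP[ac cb] sE] := @MVT R s s1 a b ab (fun v _ => sD v).
  by apply: continuous_subspaceT; exact: branch_continuous.
by rewrite -subr_gt0 sE mulr_gt0 ?subr_gt0//; case: (I_down cb Ib).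
Qed.

Lemma branch_inj : {in I &, injective s}.
Proof.
move=> a b /set_mem Ia /set_mem Ib sab.
have [/branch_increasing/(_ Ib)|/branch_increasing/(_ Ia)|//] := ltgtP a b;
  by rewrite sab ltxx.
Qed.

Lemma branch_invK v : I v -> u (s v) = v.
Proof. by move=> Iv; apply: pinvKV; [exact: branch_inj | exact: mem_set]. Qed.

Lemma branch_solve (t : R) : t < 0 -> exists2 v, v < u0 & s v = t.
Proof.
move=> t0; have [a au0 sa] := s_Ny t0.
have [||c /[!in_itv]/= /andP[_ cu0] sc] := @IVT R s a u0 t au0.
- by apply: continuous_subspaceT; exact: branch_continuous.
- by rewrite ge_min sa le_max (ltW (lt_le_trans t0 su0)) orbT.
(* Strictness, from s u0 >= 0 > t, leaves a neighbourhood of the solution inside [I], as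
   differentiating the inverse requires. *)
exists c => //; rewrite lt_neqAle cu0 andbT; apply/eqP => cE.
by move: t0; rewrite -sc cE ltNge su0.
Qed.

Lemma branch_inv (t : R) : t < 0 -> u t < u0 /\ s (u t) = t.
Proof.
move=> /branch_solve[v vu0 <-]; have [Iv _] := I_down vu0 Iu0.
by rewrite branch_invK.
Qed.

Lemma branch_inv_mem (t : R) : t < 0 -> I (u t).
Proof. by move=> /branch_inv[/I_down/(_ Iu0)[]]. Qed.

Lemma branch_slope (t : R) : t < 0 -> 0 < s1 (u t).
Proof. by move=> /branch_inv[/I_down/(_ Iu0)[]]. Qed.

Lemma branch_inv_derive (t : R) : t < 0 -> is_derive t 1 u (s1 (u t))^-1.
Proof.
move=> t0; have [uu0 sE] := branch_inv t0.
rewrite -{1}sE; apply: is_derive_inverse.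
- near=> v; apply: branch_invK; apply: (proj1 (I_down _ Iu0)).
  near: v; exact: lt_nbhsl.
- by near=> v; exact: branch_continuous.
- exact: sD.
- by rewrite gt_eqF// branch_slope.
Unshelve. all: by end_near. Qed.

Lemma branch_ode mu nu (s2 : R -> R) :
  (forall v : R, has_derive v 1 s1 (s2 v)) ->
  (forall v, s2 v = mu * s1 v - nu * s v) -> inverse_ode u (s1 \o u) mu nu.
Proof.
move=> s1D s2E t t0; have V0 := branch_slope t0; have uD := branch_inv_derive t0.
have [_ sE] := branch_inv t0; split => //; first by rewrite /= gt_eqF.
apply: (@has_derive_eq _ _ _ _ _ _ _ (is_derive_chain uD (s1D (u t)))).
by rewrite s2E sE /=; field; rewrite gt_eqF.
Qed.

End InverseBranch.

(** * The individual families of costs *)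

Section Cases.
Context {R : realType} {n : nat}.

Lemma has_derive_affine (b0 b1 v : R) : has_derive v 1 (fun v => b0 + b1 * v) b1.
Proof.
apply: has_derive_eq.
  apply: has_derive_add; first exact: is_derive_cst.
  by apply: has_derive_scale; exact: is_derive_id.
by rewrite add0r mulr1.
Qed.

Lemma has_derive_ln_affine (b0 b1 v : R) : 0 < b0 + b1 * v ->
  has_derive v 1 (fun v => ln (b0 + b1 * v)) ((b0 + b1 * v)^-1 * b1).
Proof.
by move=> h; exact: (is_derive_chain (has_derive_affine b0 b1 v) (is_derive1_ln h)).
Qed.

Lemma has_derive_expM (p v : R) :
  has_derive v 1 (fun v => expR (p * v)) (p * expR (p * v)).
Proof.
have pD : has_derive v 1 (fun v => p * v) (p * 1).
  by apply: has_derive_scale; exact: is_derive_id.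
apply: has_derive_eq; first exact: (is_derive_chain pD (is_derive_expR (p * v))).
by rewrite mulr1 mulrC.
Qed.

(** Both hyperbolic cases at once; the distinguished point of [I] is the zero of [s]. *)
Lemma hyperbolic_A3s (I : set R) (p0 p1 p2 p3 : R) :
  p0 < 0 -> p1 < 0 -> 0 < p2 -> p1 < p3 -> p3 <= - p1 ->
  (forall a b, a < b -> I b ->
     I a /\ 0 < p0 * p1 * expR (p1 * a) + p2 * p3 * expR (p3 * a)) ->
  I (ln (- p0 / p2) / (p3 - p1)) ->
  A3s (@inner_cost R n (inverse_on I
    (fun u => p0 * expR (p1 * u) + p2 * expR (p3 * u)))).
Proof.
move=> p00 p10 p20 p13 p31 Id Iu0; set s := fun u => _.
pose s1 v := p0 * p1 * expR (p1 * v) + p2 * p3 * expR (p3 * v).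
pose u0 := ln (- p0 / p2) / (p3 - p1).
have sD (v : R) : has_derive v 1 s (s1 v).
  rewrite /s1 -!mulrA.
  by apply: has_derive_add; apply: has_derive_scale; exact: has_derive_expM.
pose s2 v := p0 * p1 * (p1 * expR (p1 * v)) + p2 * p3 * (p3 * expR (p3 * v)).
have s1D (v : R) : has_derive v 1 s1 (s2 v).
  by apply: has_derive_add; apply: has_derive_scale; exact: has_derive_expM.
have su0 : s u0 = 0.
  have e0 : expR (p3 * u0) = expR (p1 * u0) * (- p0 / p2).
    have -> : - p0 / p2 = expR (ln (- p0 / p2)).
      by rewrite lnK// posrE divr_gt0// oppr_gt0.
    rewrite -expRD; congr expR; rewrite /u0; field.
    by rewrite subr_eq0 gt_eqF.
  by rewrite /s e0; field; rewrite gt_eqF.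
have s_Ny (t : R) : t < 0 -> exists2 v, v <= u0 & s v <= t.
  move=> t0.
  (* For v <= 0: if p3 >= 0 then s v <= p0 exp (p1 v) + p2; otherwise
     s v = exp (p3 v) (p0 exp ((p1 - p3) v) + p2) with exp (p3 v) >= 1. *)
  pose q := p1 - Num.min p3 0.
  have q0 : q < 0 by rewrite /q subr_lt0 lt_min p13 p10.
  have p0q : 0 < p0 * q by rewrite nmulr_rgt0.
  (* The last entry solves p0 (1 + q v) + p2 = t, the bound obtained from exp x >= 1 + x. *)
  pose v := Num.min (Num.min u0 0) ((t - p2 - p0) / (p0 * q)).
  have vu0 : v <= u0 by rewrite /v !ge_min lexx.
  have v0 : v <= 0 by rewrite /v !ge_min lexx orbT.
  have vt : p0 * (1 + q * v) + p2 <= t.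
    have : v <= (t - p2 - p0) / (p0 * q) by rewrite /v !ge_min lexx !orbT.
    by rewrite ler_pdivlMr//; lra.
  exists v => //.
  have b0 : p0 * expR (q * v) + p2 <= t.
    by apply: le_trans vt; rewrite lerD2r ler_nM2l// expR_ge1Dx.
  rewrite /s; have [p30|p30] := leP 0 p3.
    apply: le_trans b0; rewrite /q min_r// subr0 lerD2l ler_piMr ?(ltW p20)//.
    by rewrite -expR0 ler_expR mulr_ge0_le0.
  have e1 : 1 <= expR (p3 * v) by rewrite -expR0 ler_expR mulr_le0// ltW.
  have eE : expR (p1 * v) = expR (p3 * v) * expR (q * v).
    by rewrite -expRD /q min_l ?ltW//; congr expR; ring.
  rewrite eE mulrCA [p2 * _]mulrC -mulrDr.
  by move: b0 e1 t0; move: (expR (p3 * v)) (p0 * _ + _) => e b; nra.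
have s0 : 0 <= s u0 by rewrite su0.
(* The exponents [p1] and [p3] are the roots of the characteristic polynomial, so [mu] is their sum
   and [nu] their product. *)
have ode : inverse_ode (inverse_on I s) (s1 \o inverse_on I s) (p1 + p3) (p1 * p3).
  by apply: (branch_ode sD Id Iu0 s0 s_Ny s1D) => v; rewrite /s2 /s1 /s; ring.
apply: (inverse_ode_A3s ode) => t tN1.
have t0 : t < 0 by apply: le_lt_trans tN1 _; rewrite oppr_lt0.
have := branch_slope sD Id Iu0 s0 s_Ny t0.
have [_] := branch_inv sD Id Iu0 s0 s_Ny t0.
rewrite /nondeg /wronskian /scnd /s /s1 /=.
have := expR_gt0 (p1 * inverse_on I s t); have := expR_gt0 (p3 * inverse_on I s t).
move: (expR (p1 * _)) (expR (p3 * _)) => E F F0 E0 tE V0.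
rewrite -tE.
have q0 : 0 < - p0 * p2 * (p1 - p3) ^+ 2 * (E * F).
  have sq : 0 < (p1 - p3) ^+ 2 by rewrite exprn_even_gt0//= subr_eq0 lt_eqF.
  by apply: mulr_gt0; [apply: mulr_gt0; rewrite // mulr_gt0// oppr_gt0 | exact: mulr_gt0].
have X0 : 0 < - p0 * E by rewrite mulr_gt0 ?oppr_gt0.
have Y0 : 0 < p2 * F by rewrite mulr_gt0.
have p33 : p3 ^+ 2 <= p1 ^+ 2 by nra.
(* Since p3^2 <= p1^2, s'' is at most p1^2 s = p1^2 t < 0. *)
have S0 : p0 * p1 ^+ 2 * E + p2 * p3 ^+ 2 * F < 0.
  have : p2 * F * p3 ^+ 2 <= p2 * F * p1 ^+ 2 by rewrite ler_pM2l.
  have : 0 < p1 ^+ 2 by rewrite exprn_even_gt0//= lt_eqF.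
  by move: tE tN1; nra.
have wE : (p0 * p1 * E + p2 * p3 * F) ^+ 2 - (p0 * E + p2 * F) *
    ((p1 + p3) * (p0 * p1 * E + p2 * p3 * F) - p1 * p3 * (p0 * E + p2 * F)) =
    - p0 * p2 * (p1 - p3) ^+ 2 * (E * F) by ring.
split => //.
- by move: q0; rewrite -wE; lra.
- have : (p0 * E + p2 * F) * (- p0 * p2 * (p1 - p3) ^+ 2 * (E * F)) < 0.
    by rewrite pmulr_llt0// tE.
  by move: S0; lra.
- have V2 : 0 < (p0 * p1 * E + p2 * p3 * F) ^+ 2 by rewrite exprn_gt0.
  have t2 : 0 <= (p0 * E + p2 * F) ^+ 2 - 1 by rewrite tE; nra.
  have [p30|p30] := leP p3 0.
    by rewrite ltr_wpDr// mulr_ge0// mulr_le0// ltW.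
  (* For p3 > 0 the quantity V^2 + nu (t^2 - 1) equals [c1] + 4 [c2] + [c3], with the three terms
     bounded below. *)
  have XY : (p2 * F) ^+ 2 <= (p0 * E) ^+ 2.
    by rewrite -(sqrrN (p0 * E)) -mulNr ler_pXn2r// ?nnegrE ?ltW//; move: tE tN1; lra.
  have c1 : 0 <= - (p1 + p3) * (- p1 * (p0 * E) ^+ 2 - p3 * (p2 * F) ^+ 2).
    apply: mulr_ge0; first by lra.
    have : p3 * (p2 * F) ^+ 2 <= p3 * (p0 * E) ^+ 2 by rewrite ler_pM2l.
    have : 0 <= (- p1 - p3) * (p0 * E) ^+ 2 by rewrite mulr_ge0 ?sqr_ge0//; lra.
    by lra.
  have c2 : 0 < (- p0 * E) * (p2 * F) * (- p1 * p3).
    by apply: mulr_gt0; [exact: mulr_gt0 | rewrite mulr_gt0 ?oppr_gt0].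
  have c3 : 0 < - p1 * p3 by rewrite mulr_gt0 ?oppr_gt0.
  by move: c1 c2 c3; lra.
Qed.

(** * The Lambert family, with a double characteristic root [a2] *)

Section Lambert.
Variables a0 a1 a2 : R.
Hypotheses (a10 : 0 < a1) (a20 : a2 < 0).

Let a1n : a1 != 0. Proof. by rewrite gt_eqF. Qed.
Let a2n : a2 != 0. Proof. by rewrite lt_eqF. Qed.

Let s v := (a0 + a1 * v) * expR (a2 * v).
Let s1 v := (a1 + a2 * (a0 + a1 * v)) * expR (a2 * v).
Let uc := - ((a0 * a2 + a1) / (a1 * a2)).
Let I := [set u | u <= uc].

Lemma lambert_derive (v : R) : has_derive v 1 s (s1 v).
Proof.
apply: has_derive_eq.
  by apply: has_derive_mul; [exact: has_derive_affine | exact: has_derive_expM].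
by rewrite /s1; ring.
Qed.

Lemma lambert_down a b : a < b -> I b -> I a /\ 0 < s1 a.
Proof.
move=> ab /= bu; have au := lt_le_trans ab bu; split; first exact: ltW.
rewrite mulr_gt0 ?expR_gt0//.
have a12 : 0 < - (a1 * a2) by rewrite oppr_gt0 pmulr_rlt0.
have : - (a1 * a2) * a < - (a1 * a2) * uc by rewrite ltr_pM2l.
have -> : - (a1 * a2) * uc = a0 * a2 + a1 by rewrite /uc; field; rewrite ?a1n ?a2n.
by lra.
Qed.

Lemma lambert_ode : inverse_ode (inverse_on I s) (s1 \o inverse_on I s) (2 * a2) (a2 ^+ 2) /\
  forall t : R, t < 0 -> [/\ I (inverse_on I s t), s (inverse_on I s t) = t &
    0 < s1 (inverse_on I s t)].
Proof.
pose u0 := - a0 / a1.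
have Iu0 : I u0.
  rewrite /I /= -subr_ge0 (_ : uc - u0 = - a2^-1); last first.
    by rewrite /uc /u0; field; rewrite ?a1n ?a2n.
  by rewrite oppr_ge0 invr_le0 ltW.
have su0 : 0 <= s u0.
  by rewrite /s (_ : a0 + a1 * u0 = 0) ?mul0r//; rewrite /u0; field; rewrite ?a1n.
have s_Ny (t : R) : t < 0 -> exists2 v, v <= u0 & s v <= t.
  move=> t0; pose v := Num.min (Num.min u0 0) ((t - a0) / a1); exists v.
    by rewrite /v !ge_min lexx.
  have v0 : v <= 0 by rewrite /v !ge_min lexx orbT.
  have vt : a0 + a1 * v <= t.
    have : v <= (t - a0) / a1 by rewrite /v !ge_min lexx !orbT.
    by rewrite ler_pdivlMr//; lra.
  have e1 : 1 <= expR (a2 * v) by rewrite -expR0 ler_expR mulr_le0// ltW.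
  by rewrite /s; move: vt e1 t0; move: (expR _) (a0 + _) => e b; nra.
split; last first.
  move=> t t0; have [_ sE] := branch_inv lambert_derive lambert_down Iu0 su0 s_Ny t0.
  split=> //; first exact: (branch_inv_mem lambert_derive lambert_down Iu0 su0 s_Ny t0).
  exact: (branch_slope lambert_derive lambert_down Iu0 su0 s_Ny t0).
pose s2 v := (a2 * a1) * expR (a2 * v) + (a1 + a2 * (a0 + a1 * v)) * (a2 * expR (a2 * v)).
have s1D (v : R) : has_derive v 1 s1 (s2 v).
  apply: has_derive_mul; last exact: has_derive_expM.
  apply: has_derive_eq.
    apply: has_derive_add; first exact: is_derive_cst.
    by apply: has_derive_scale; exact: has_derive_affine.
  by rewrite add0r.
apply: (branch_ode lambert_derive lambert_down Iu0 su0 s_Ny s1D) => v.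
by rewrite /s2 /s1 /s; ring.
Qed.

Lemma lambert_A3s : A3s (@inner_cost R n (inverse_on I s)).
Proof.
have [ode ut] := lambert_ode; apply: (inverse_ode_A3s ode) => t tN1.
have t0 : t < 0 by apply: le_lt_trans tN1 _; rewrite oppr_lt0.
have [_ tE V0] := ut t t0; rewrite /nondeg /wronskian /scnd /=.
(* The Wronskian is the square of a1 exp(a2 v), and s'' is a sum of two negative terms. *)
move: (inverse_on I s t) tE V0 => v tE V0.
have t2 : 0 <= t ^+ 2 - 1 by nra.
have wE : s1 v ^+ 2 - t * (2 * a2 * s1 v + - a2 ^+ 2 * t) =
    (a1 * expR (a2 * v)) ^+ 2.
  by rewrite -tE /s1 /s; ring.
have SE : 2 * a2 * s1 v + - a2 ^+ 2 * t =
    2 * (a1 * expR (a2 * v)) * a2 + a2 ^+ 2 * t.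
  by rewrite -tE /s1 /s; ring.
have e0 : 0 < a1 * expR (a2 * v) by rewrite mulr_gt0 ?expR_gt0.
split => //.
- by rewrite wE exprn_gt0.
- rewrite wE SE.
  have : t * (a1 * expR (a2 * v)) ^+ 2 < 0.
    by rewrite pmulr_llt0// exprn_gt0.
  have : a1 * expR (a2 * v) * a2 < 0 by rewrite pmulr_rlt0.
  have : a2 ^+ 2 * t <= 0 by rewrite mulr_ge0_le0 ?sqr_ge0// ltW.
  by lra.
- by rewrite ltr_wpDr ?exprn_gt0// mulr_ge0// sqr_ge0.
Qed.

Lemma lambert_inj : {in I &, injective s}.
Proof. exact: branch_inj lambert_derive lambert_down. Qed.

End Lambert.

Lemma LambertW0K (w : R) : -1 <= w -> LambertW0 (w * expR w) = w.
Proof.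
move=> w1; apply: pinvKV; last by rewrite inE /= in_itv/= w1.
(* Injectivity of w exp w on w >= -1 is that of v exp(-v) on v <= 1 under v = -w. *)
have := @lambert_inj 0 1 (-1) ltr01 (ltrN10 R).
rewrite mul0r add0r mul1r mul1r invrN1 opprK.
move=> inj x y; rewrite !inE/= !in_itv/= !andbT => x1 y1 xy.
have h (v : R) : -1 <= v -> - v \in [set v | v <= 1].
  by move=> v1; apply/mem_set; rewrite /= lerNl.
apply: oppr_inj; apply: (inj _ _ (h _ x1) (h _ y1)).
by rewrite !add0r !mul1r !mulN1r !opprK !mulNr xy.
Qed.

Lemma lambert_closed_form (a0 a1 a2 t : R) : 0 < a1 -> a2 < 0 -> t < 0 ->
  inverse_on [set u | u <= - ((a0 * a2 + a1) / (a1 * a2))]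
    (fun u => (a0 + a1 * u) * expR (a2 * u)) t =
  1 / a2 * LambertW0 (a2 * expR (a0 * a2 / a1) / a1 * t) - a0 / a1.
Proof.
move=> a10 a20 t0; have [_ /(_ t t0)] := lambert_ode a0 a10 a20.
set u := inverse_on _ _ t => -[uuc tE V0].
have a1n : a1 != 0 by rewrite gt_eqF.
have a2n : a2 != 0 by rewrite lt_eqF.
(* The substitution that turns s u = t into the Lambert equation; positivity of the slope gives w >
   -1, the principal branch. *)
pose w := a2 * u + a0 * a2 / a1.
have wE : a2 * expR (a0 * a2 / a1) / a1 * t = w * expR w.
  by rewrite -tE /w expRD; field.
rewrite wE LambertW0K; first by rewrite /w; field; rewrite a1n a2n.
have := V0; rewrite pmulr_lgt0 ?expR_gt0// => h.
have -> : w = a2 * (a0 + a1 * u) / a1 by rewrite /w; field.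
by rewrite ler_pdivlMr//; lra.
Qed.

Lemma affineE (a0 a1 t : R) : a1 != 0 ->
  inverse_on setT (fun u : R => a0 + a1 * u) t = 1 / a1 * (t - a0).
Proof.
move=> a10; set s := fun u : R => _.
have -> : t = s (1 / a1 * (t - a0)) by rewrite /s; field.
rewrite [LHS]pinvKV ?inE//; first by rewrite /s; field.
by move=> x y _ _ /addrI/mulfI; exact.
Qed.

Lemma affine_A3s (a0 a1 : R) : 0 < a1 ->
  A3s (@inner_cost R n (inverse_on setT (fun u : R => a0 + a1 * u))).
Proof.
move=> a10; have a1n : a1 != 0 by rewrite gt_eqF.
have -> : inverse_on setT (fun u : R => a0 + a1 * u) = fun t => 1 / a1 * (t - a0).
  by apply/funext => t; exact: affineE.
have ode : inverse_ode (fun t => 1 / a1 * (t - a0)) (cst a1) 0 0.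
  move=> t _; split=> //.
    apply: has_derive_eq; first apply: has_derive_scale.
      by apply: has_derive_add; [exact: is_derive_id | exact: is_derive_cst].
    by rewrite addr0 mulr1 mul1r.
  by rewrite !mul0r subrr; exact: is_derive_cst.
apply: (inverse_ode_A3s ode) => t tN1.
have t0 : t < 0 by apply: le_lt_trans tN1 _; rewrite oppr_lt0.
have q0 : 0 < a1 ^+ 2 by rewrite exprn_gt0.
rewrite /nondeg /wronskian /scnd /= !mul0r oppr0 !mul0r !addr0 mulr0 subr0.
by split=> //; rewrite pmulr_llt0.
Qed.

Lemma log_one_sub_A3s (c k : R) : 0 < c -> 0 < k ->
  A3s (@inner_cost R n (fun t => - (1 / k) * ln ((1 - t) / c))).
Proof.
move=> c0 k0.
(* Here s u = 1 - c exp(-k u), so s' = k (1 - s) and s'' = -k s'. *)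
have ode : inverse_ode (fun t => - (1 / k) * ln ((1 - t) / c)) (fun t => k * (1 - t)) (- k) 0.
  rewrite (_ : (fun t => _ * ln _) = fun t => - (1 / k) * ln (c^-1 + - c^-1 * t)); last first.
    by apply/funext => t; congr (_ * ln _); field; rewrite gt_eqF.
  rewrite (_ : (fun t => k * _) = fun t => k + - k * t); last first.
    by apply/funext => t; ring.
  move=> t t0; have t1 : 0 < 1 - t by rewrite subr_gt0 (lt_trans t0).
  have kE : k + - k * t = k * (1 - t) by ring.
  have cE : c^-1 + - c^-1 * t = c^-1 * (1 - t) by ring.
  split; first by rewrite kE mulf_neq0 ?gt_eqF.
    apply: has_derive_eq.
      by apply: has_derive_scale; apply: has_derive_ln_affine; rewrite cE mulr_gt0 ?invr_gt0.
    by rewrite cE kE; field; rewrite !gt_eqF.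
  by rewrite !mul0r subr0; exact: has_derive_affine.
apply: (inverse_ode_A3s ode) => t tN1.
have t1 : 0 < 1 - t by rewrite subr_gt0 (le_lt_trans tN1)// ltrN10.
have V0 : 0 < k * (1 - t) by rewrite mulr_gt0.
have kk : 0 < k * (k * (1 - t)) by rewrite mulr_gt0.
rewrite /nondeg /wronskian /scnd; split => //.
- by rewrite (_ : _ - _ = k * (k * (1 - t)))//; ring.
- rewrite (_ : t * _ + _ = - (k * (k * (1 - t)) * (1 - t))); last by ring.
  by rewrite oppr_lt0 mulr_gt0.
- by rewrite mul0r addr0 exprn_gt0.
Qed.

Lemma log_A3w (c k : R) : 0 < c -> k != 0 ->
  A3w (@inner_cost R n (fun t => 1 / k * ln (- t / c))).
Proof.
move=> c0 k0.
(* Here s u = -c exp(k u), so s' = k s, which makes the Wronskian vanish. *)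
have ode : inverse_ode (fun t => 1 / k * ln (- t / c)) (fun t => k * t) k 0.
  rewrite (_ : (fun t => _ * ln _) = fun t => 1 / k * ln (0 + - c^-1 * t)); last first.
    by apply/funext => t; congr (_ * ln _); field; rewrite gt_eqF.
  move=> t t0; split; first by rewrite mulf_neq0 // lt_eqF.
    apply: has_derive_eq.
      apply: has_derive_scale; apply: has_derive_ln_affine.
      by rewrite add0r nmulr_rgt0// oppr_lt0 invr_gt0.
    by rewrite add0r; field; rewrite ?k0 ?(gt_eqF c0) ?(lt_eqF t0).
  apply: has_derive_eq; first by apply: has_derive_scale; exact: is_derive_id.
  by rewrite !mul0r subr0 mulr1.
apply: (inverse_ode_A3w ode) => t tN1.
have t0 : t < 0 by rewrite (le_lt_trans tN1)// ltrN10.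
rewrite /nondeg /wronskian /scnd; split; first by ring.
rewrite (_ : _ + _ = k ^+ 2 * t); last by ring.
by rewrite mulf_neq0 ?expf_neq0// lt_eqF.
Qed.

Lemma lorentz_lt0 (x xb : 'rV[R]_n.+1) :
  hyperboloid x -> hyperboloid xb -> lorentz x xb < 0.
Proof.
by move=> /mem_set/hparamK<- /mem_set/hparamK<-; exact: lorentz_hparam_lt0.
Qed.

End Cases.

Theorem theorem3 (R : realType) (n : nat) :
  (* generalized hyperbolic, sinh-like *)
  (forall p0 p1 p2 p3 : R,
     p0 < 0 -> p1 < 0 -> 0 < p2 -> 0 <= p3 <= - p1 ->
     let s := fun u : R => p0 * expR (p1 * u) + p2 * expR (p3 * u) in
     A3s (@inner_cost R n (inverse_on setT s))) /\
  (* generalized hyperbolic, one-side range *)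
  (forall p0 p1 p2 p3 : R,
     p0 < 0 -> p1 < 0 -> 0 < p2 -> p1 < p3 < 0 ->
     let s := fun u : R => p0 * expR (p1 * u) + p2 * expR (p3 * u) in
     let uc := 1 / (p1 - p3) * ln (- p2 * p3 / (p0 * p1)) in
     A3s (@inner_cost R n (inverse_on [set u | u <= uc] s))) /\
  (* Lambert *)
  (forall a0 a1 a2 : R,
     0 < a1 -> a2 < 0 ->
     let s := fun u : R => (a0 + a1 * u) * expR (a2 * u) in
     let uc := - ((a0 * a2 + a1) / (a1 * a2)) in
     let c := @inner_cost R n (inverse_on [set u | u <= uc] s) in
     A3s c /\
     (forall x xb : 'rV[R]_n.+1, hyperboloid x -> hyperboloid xb ->
        c x xb = 1 / a2 * LambertW0 (a2 * expR (a0 * a2 / a1) / a1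
                                     * lorentz x xb) - a0 / a1)) /\
  (* affine *)
  (forall a0 a1 : R,
     0 < a1 ->
     let s := fun u : R => a0 + a1 * u in
     let c := @inner_cost R n (inverse_on setT s) in
     A3s c /\
     (forall x xb : 'rV[R]_n.+1, hyperboloid x -> hyperboloid xb ->
        c x xb = 1 / a1 * (lorentz x xb - a0))) /\
  (* logarithmic costs *)
  (forall p0 p1 : R,
     p0 != 0 -> p1 != 0 ->
     A3s (fun x xb : 'rV[R]_n.+1 =>
            - (1 / `|p1|) * ln ((1 - lorentz x xb) / `|p0|)) /\
     A3w (fun x xb : 'rV[R]_n.+1 =>
            1 / p1 * ln (- lorentz x xb / `|p0|))).

Proof.
split=> [p0 p1 p2 p3 p00 p10 p20 /andP[p30 p31]|].
  apply: hyperbolic_A3s => //; first exact: lt_le_trans p30.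
  move=> a b _ _; split=> //; apply: ltr_wpDr.
    by rewrite mulr_ge0 ?expR_ge0// mulr_ge0// ltW.
  by rewrite mulr_gt0 ?expR_gt0// nmulr_rgt0.
split=> [p0 p1 p2 p3 p00 p10 p20 /andP[p13 p30] s uc|].
  have p130 : p1 - p3 < 0 by rewrite subr_lt0.
  have p01 : 0 < p0 * p1 by rewrite nmulr_rgt0.
  have r0 : 0 < - p2 * p3 / (p0 * p1) by rewrite divr_gt0// mulNr oppr_gt0 pmulr_rlt0.
  have ucE : (p1 - p3) * uc = ln (- p2 * p3 / (p0 * p1)).
    by rewrite /uc; field; rewrite lt_eqF.
  apply: hyperbolic_A3s => //; first lra.
    move=> a b ab /= bu; have au := lt_le_trans ab bu; split; first exact: ltW.
    have : (p1 - p3) * uc < (p1 - p3) * a by rewrite ltr_nM2l.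
    rewrite ucE -ltr_expR lnK ?posrE// ltr_pdivrMr// => h.
    (* Factoring exp(p3 a) out of the slope leaves an expression whose sign changes at [uc]. *)
    have -> : p1 * a = p3 * a + (p1 - p3) * a by ring.
    rewrite expRD (_ : _ + _ = expR (p3 * a) *
      (expR ((p1 - p3) * a) * (p0 * p1) - - p2 * p3)); last by ring.
    by rewrite mulr_gt0 ?expR_gt0// subr_gt0.
  (* The zero of [s] lies left of [uc]: after exponentiation this is p1 <= p3. *)
  rewrite /= -(ler_nM2l p130) ucE.
  have -> : (p1 - p3) * (ln (- p0 / p2) / (p3 - p1)) = - ln (- p0 / p2).
    by field; rewrite subr_eq0 gt_eqF.
  have p02 : 0 < - p0 / p2 by rewrite divr_gt0// oppr_gt0.
  rewrite -lnV ?posrE// ler_ln ?posrE ?invr_gt0//.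
  rewrite ler_pdivrMr// (_ : (- p0 / p2)^-1 * (p0 * p1) = - p2 * p1); last first.
    by field; rewrite gt_eqF// lt_eqF.
  by rewrite ler_nM2l ?oppr_lt0// ltW.
split=> [a0 a1 a2 a10 a20 s uc c|].
  split; first exact: lambert_A3s.
  by move=> x xb hx hxb; apply: lambert_closed_form => //; exact: lorentz_lt0.
split=> [a0 a1 a10 s c|p0 p1 p00 p10].
  split; first exact: affine_A3s.
  by move=> x xb _ _; apply: affineE; rewrite gt_eqF.
split; first by apply: log_one_sub_A3s; rewrite normr_gt0.
by apply: log_A3w; rewrite ?normr_gt0.
Qed.
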